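(* Assume $\mathsf{ZF}+\mathsf{AD}$. Let $\kappa$ be a regular cardinal and let $\lambda<\kappa$ be an ordinal. Let $(\Gamma,\mathrm{decode},\mathrm{GC}_{\beta,\gamma}:\beta<\omega\cdot\lambda,\ \gamma<\kappa)$ be a good coding system for ${}^{\omega\cdot\lambda}\kappa$. Let $R\subseteq[\kappa]^\lambda_*\times\mathbb{R}$ be a relation, and let $\mathrm{dom}(R)=\{f:\exists x\,R(f,x)\}$. Then there exist a club $C\subseteq\kappa$ and a Lipschitz continuous function $F:\mathbb{R}\to\mathbb{R}$ such that for every $x\in\mathrm{GC}$ with $\mathrm{decode}(x)\in[C]^{\omega\cdot\lambda}$ and $\mathrm{block}(\mathrm{decode}(x))\in[C]^\lambda_*\cap\mathrm{dom}(R)$, one has $R(\mathrm{block}(\mathrm{decode}(x)),F(x))$.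
   Context: For a set $A$ of ordinals and an ordinal $\delta$, $[A]^\delta$ denotes the set of order-preserving (strictly increasing) functions $\delta\to A$. A function $f:\delta\to\kappa$ has uniform cofinality $\omega$ if there is $g:\delta\times\omega\to\kappa$ with $g(\alpha,m)<g(\alpha,n)$ for all $\alpha<\delta$, $m<n$, and $f(\alpha)=\sup_{n\in\omega}g(\alpha,n)$ for all $\alpha<\delta$. $f$ is discontinuous everywhere if $f(\alpha)>\sup\{f(\beta):\beta<\alpha\}$ for all $\alpha<\delta$. $f$ has the correct type if it has uniform cofinality $\omega$ and is discontinuous everywhere. $[A]^\delta_*$ is the set of $f\in[A]^\delta$ of the correct type. For $f\in{}^{\omega\cdot\lambda}\kappa$, $\mathrm{block}(f)\in{}^\lambda\kappa$ is defined by $\mathrm{block}(f)(\alpha)=\sup\{f(\omega\cdot\alpha+k):k\in\omega\}$. Good coding system: for a regular cardinal $\kappa$ and an ordinal $\theta\le\kappa$, a good coding system for ${}^\theta\kappa$ consists of $\Gamma$, $\mathrm{decode}$, and sets $\mathrm{GC}_{\beta,\gamma}$ ($\beta<\theta,\gamma<\kappa$) such that: (1) $\Gamma$ is a pointclass closed under continuous substitution and under $\exists^{\mathbb{R}}$; let $\check\Gamma$ be its dual and $\Delta=\Gamma\cap\check\Gamma$. (2) $\mathrm{decode}:\mathbb{R}\to\mathcal{P}(\theta\times\kappa)$, and for every $f\in{}^\theta\kappa$ there is $x\in\mathbb{R}$ with $\mathrm{decode}(x)=f$ (as a graph). (3) Each $\mathrm{GC}_{\beta,\gamma}\subseteq\mathbb{R}$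 belongs to $\Delta$, and $x\in\mathrm{GC}_{\beta,\gamma}$ iff $(\beta,\gamma)\in\mathrm{decode}(x)$ and for all $\gamma'<\kappa$, $(\beta,\gamma')\in\mathrm{decode}(x)$ implies $\gamma'=\gamma$. Let $\mathrm{GC}_\beta=\bigcup_{\gamma<\kappa}\mathrm{GC}_{\beta,\gamma}$. (4) (Boundedness) If $A\in\exists^{\mathbb{R}}\Delta$ and $A\subseteq\mathrm{GC}_\beta$, then there is $\delta<\kappa$ with $A\subseteq\bigcup_{\gamma<\delta}\mathrm{GC}_{\beta,\gamma}$. (5) $\Delta$ is closed under wellordered unions of length less than $\kappa$. Let $\mathrm{GC}=\bigcap_{\beta<\theta}\mathrm{GC}_\beta$; for $x\in\mathrm{GC}$, $\mathrm{decode}(x)$ is the graph of a function in ${}^\theta\kappa$, and $\mathrm{decode}(x)\in[C]^{\theta}$ means this function is order-preserving with values in $C$. *)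

(* Defs.v *)
(* AD contradicts the axiom of choice, so the theory ZF + AD is not rendered by
   assuming AD about the types of the ambient logic, nor about a model of
   second-order ZF (which would inherit choice from the ambient logic).
   Instead, "assume ZF + AD" means: (V, ∈) is an arbitrary structure satisfying
   the first-order axioms of ZF, with the Separation and Replacement schemas
   ranging over formulas with parameters, and satisfying AD.  Every notion below
   quantifies over elements of V only, so it is the interpretation in V of a
   first-order formula of set theory. *)

Record setStructure := SetStructure {
  carrier :> Type;
  mem : carrier -> carrier -> Prop
}.
Arguments mem {s} _ _.
Notation "x ∈ y" := (mem x y) (at level 70, no associativity).

(* Formulas of the language {∈} with de Bruijn variables. *)
Inductive formula : Type :=
| FMem (i j : nat)
| FEq (i j : nat)
| FBot
| FImp (p q : formula)
| FAnd (p q : formula)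
| FOr (p q : formula)
| FAll (p : formula)
| FEx (p : formula).

Definition scons {V : Type} (a : V) (e : nat -> V) (n : nat) : V :=
  match n with O => a | S m => e m end.

Fixpoint sat {V : setStructure} (e : nat -> V) (p : formula) : Prop :=
  match p with
  | FMem i j => e i ∈ e j
  | FEq i j => e i = e j
  | FBot => False
  | FImp p q => sat e p -> sat e q
  | FAnd p q => sat e p /\ sat e q
  | FOr p q => sat e p \/ sat e q
  | FAll p => forall a : V, sat (scons a e) p
  | FEx p => exists a : V, sat (scons a e) p
  end.

Definition is_empty {V : setStructure} (x : V) : Prop := forall z, ~ z ∈ x.

Definition subset {V : setStructure} (x y : V) : Prop :=
  forall z, z ∈ x -> z ∈ y.

Definition is_succ {V : setStructure} (x s : V) : Prop :=
  forall z, z ∈ s <-> z ∈ x \/ z = x.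

Definition is_upair {V : setStructure} (a b p : V) : Prop :=
  forall z, z ∈ p <-> z = a \/ z = b.

Definition is_power {V : setStructure} (x P : V) : Prop :=
  forall z, z ∈ P <-> subset z x.

Definition is_union {V : setStructure} (x U : V) : Prop :=
  forall z, z ∈ U <-> exists y, y ∈ x /\ z ∈ y.

Record ZF (V : setStructure) : Prop := {
  ZF_extensionality : forall x y : V, (forall z, z ∈ x <-> z ∈ y) -> x = y;
  ZF_foundation : forall x : V, (exists y, y ∈ x) ->
    exists y, y ∈ x /\ forall z, z ∈ x -> ~ z ∈ y;
  ZF_pairing : forall a b : V, exists p, is_upair a b p;
  ZF_union : forall x : V, exists U, is_union x U;
  ZF_power : forall x : V, exists P, is_power x P;
  ZF_infinity : exists I : V, (exists o, is_empty o /\ o ∈ I) /\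
    forall x, x ∈ I -> exists s, is_succ x s /\ s ∈ I;
  ZF_separation : forall (p : formula) (e : nat -> V) (A : V),
    exists B, forall x, x ∈ B <-> x ∈ A /\ sat (scons x e) p;
  ZF_replacement : forall (p : formula) (e : nat -> V) (A : V),
    (forall x, x ∈ A -> forall y y',
       sat (scons x (scons y e)) p -> sat (scons x (scons y' e)) p -> y = y') ->
    exists B, forall y,
      y ∈ B <-> exists x, x ∈ A /\ sat (scons x (scons y e)) p
}.

(* Kuratowski pairs. *)
Definition is_opair {V : setStructure} (a b p : V) : Prop :=
  exists u v, is_upair a a u /\ is_upair a b v /\ is_upair u v p.

Definition is_prod {V : setStructure} (A B P : V) : Prop :=
  forall p, p ∈ P <-> exists a b, a ∈ A /\ b ∈ B /\ is_opair a b p.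

Definition pair_in {V : setStructure} (a b r : V) : Prop :=
  exists p, is_opair a b p /\ p ∈ r.

(* f(a) = b, resp. g(a, b) = c, for a function given by its graph. *)
Notation maps f a b := (pair_in a b f) (only parsing).

Definition maps2 {V : setStructure} (g a b c : V) : Prop :=
  exists p, is_opair a b p /\ maps g p c.

Definition function_on {V : setStructure} (f A : V) : Prop :=
  (forall p, p ∈ f -> exists a b, a ∈ A /\ is_opair a b p) /\
  (forall a, a ∈ A -> exists! b, maps f a b).

Definition function {V : setStructure} (f A B : V) : Prop :=
  function_on f A /\ forall a b, maps f a b -> b ∈ B.

Definition transitive {V : setStructure} (x : V) : Prop :=
  forall y, y ∈ x -> subset y x.

Definition ordinal {V : setStructure} (a : V) : Prop :=
  transitive a /\ forall b, b ∈ a -> transitive b.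

Definition ole {V : setStructure} (a b : V) : Prop := a ∈ b \/ a = b.

Definition limit {V : setStructure} (a : V) : Prop :=
  ordinal a /\ ~ is_empty a /\ ~ exists b, is_succ b a.

Definition natural {V : setStructure} (n : V) : Prop :=
  ordinal n /\ forall m, ole m n -> is_empty m \/ exists k, is_succ k m.

Definition is_omega {V : setStructure} (w : V) : Prop :=
  forall n, n ∈ w <-> natural n.

(* s is the supremum of the class P of ordinals (0 if P is empty). *)
Definition is_sup {V : setStructure} (P : V -> Prop) (s : V) : Prop :=
  ordinal s /\ (forall a, P a -> ole a s) /\
  forall u, ordinal u -> (forall a, P a -> ole a u) -> ole s u.

(* a + b = c and a * b = c, by recursion on b: h is the function
   t |-> a + t, resp. t |-> a * t, on b + 1. *)
Definition is_add {V : setStructure} (a b c : V) : Prop :=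
  exists d h, is_succ b d /\ function_on h d /\ maps h b c /\
    forall t y, maps h t y ->
      (is_empty t -> y = a) /\
      (forall s u, is_succ s t -> maps h s u -> is_succ u y) /\
      (limit t -> is_sup (fun u => exists s, s ∈ t /\ maps h s u) y).

Definition is_mul {V : setStructure} (a b c : V) : Prop :=
  exists d h, is_succ b d /\ function_on h d /\ maps h b c /\
    forall t y, maps h t y ->
      (is_empty t -> is_empty y) /\
      (forall s u, is_succ s t -> maps h s u -> is_add u a y) /\
      (limit t -> is_sup (fun u => exists s, s ∈ t /\ maps h s u) y).

Definition is_omega_mul {V : setStructure} (a c : V) : Prop :=
  exists w, is_omega w /\ is_mul w a c.

Definition cardinal {V : setStructure} (k : V) : Prop :=
  ordinal k /\
  forall a, a ∈ k -> ~ exists f, function f a k /\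
    (forall x y z, maps f x z -> maps f y z -> x = y) /\
    (forall z, z ∈ k -> exists x, maps f x z).

Definition regular_cardinal {V : setStructure} (k : V) : Prop :=
  cardinal k /\ (exists w, is_omega w /\ ole w k) /\
  forall a f, a ∈ k -> function f a k ->
    exists b, b ∈ k /\ forall x y, maps f x y -> y ∈ b.

Definition club {V : setStructure} (C k : V) : Prop :=
  subset C k /\
  (forall a, a ∈ k -> exists b, b ∈ C /\ a ∈ b) /\
  (forall d, d ∈ k -> limit d ->
     (forall a, a ∈ d -> exists b, b ∈ C /\ b ∈ d /\ a ∈ b) -> d ∈ C).

(* Reals are elements of Baire space. *)
Definition real {V : setStructure} (x : V) : Prop :=
  exists w, is_omega w /\ function x w w.

Definition is_reals {V : setStructure} (RR : V) : Prop :=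
  forall x, x ∈ RR <-> real x.

Definition double {V : setStructure} (n d : V) : Prop := is_add n n d.

Definition even {V : setStructure} (n : V) : Prop :=
  exists m, natural m /\ double m n.

Definition odd {V : setStructure} (n : V) : Prop :=
  exists m, even m /\ is_succ m n.

(* In the game with payoff set A the players alternately play the values
   x(0), x(1), x(2), ...; the first player makes the even moves and wins iff x
   is in A.  A strategy answers every finite sequence of naturals. *)
Definition finite_sequence {V : setStructure} (s : V) : Prop :=
  exists w n, is_omega w /\ n ∈ w /\ function s n w.

Definition strategy {V : setStructure} (sigma : V) : Prop :=
  exists S w, (forall s, s ∈ S <-> finite_sequence s) /\ is_omega w /\
    function sigma S w.

Definition is_restriction {V : setStructure} (x n r : V) : Prop :=
  forall p, p ∈ r <-> p ∈ x /\ exists a b, a ∈ n /\ is_opair a b p.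

Definition plays {V : setStructure} (sigma : V) (turn : V -> Prop) (x : V)
  : Prop :=
  forall n r, turn n -> is_restriction x n r ->
    exists k, maps sigma r k /\ maps x n k.

Definition determined {V : setStructure} (A : V) : Prop :=
  (exists sigma, strategy sigma /\
     forall x, real x -> plays sigma even x -> x ∈ A) \/
  (exists tau, strategy tau /\
     forall x, real x -> plays tau odd x -> ~ x ∈ A).

Definition AD (V : setStructure) : Prop :=
  forall A : V, (forall x, x ∈ A -> real x) -> determined A.

(* x and y have the same restriction to n. *)
Definition agree {V : setStructure} (n x y : V) : Prop :=
  forall k u, k ∈ n -> (maps x k u <-> maps y k u).

Definition real_function {V : setStructure} (F : V) : Prop :=
  exists RR, is_reals RR /\ function F RR RR.

Definition continuous {V : setStructure} (F : V) : Prop :=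
  real_function F /\
  forall x x' n, maps F x x' -> natural n ->
    exists m, natural m /\
      forall y y', maps F y y' -> agree m x y -> agree n x' y'.

(* Lipschitz with constant 1 for the usual metric of Baire space. *)
Definition lipschitz {V : setStructure} (F : V) : Prop :=
  real_function F /\
  forall x x' y y' n, maps F x x' -> maps F y y' -> natural n ->
    agree n x y -> agree n x' y'.

(* z(2n) = x(n) and z(2n+1) = y(n): the standard homeomorphism of the plane
   with the line, through which a pointclass of sets of reals contains subsets
   of the plane. *)
Definition is_join {V : setStructure} (x y z : V) : Prop :=
  real z /\
  forall n d d', natural n -> double n d -> is_succ d d' ->
    (forall k, maps z d k <-> maps x n k) /\
    (forall k, maps z d' k <-> maps y n k).

Definition pointclass {V : setStructure} (Gamma : V) : Prop :=
  forall A, A ∈ Gamma -> forall x, x ∈ A -> real x.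

Definition closed_continuous_substitution {V : setStructure} (Gamma : V)
  : Prop :=
  forall F A B, continuous F -> A ∈ Gamma ->
    (forall x, x ∈ B <-> exists y, maps F x y /\ y ∈ A) -> B ∈ Gamma.

(* B = {x : exists y, (x, y) in A}. *)
Definition is_exists_real {V : setStructure} (A B : V) : Prop :=
  forall x, x ∈ B <->
    real x /\ exists y z, real y /\ is_join x y z /\ z ∈ A.

Definition closed_exists_real {V : setStructure} (Gamma : V) : Prop :=
  forall A B, A ∈ Gamma -> is_exists_real A B -> B ∈ Gamma.

Definition in_dual {V : setStructure} (Gamma A : V) : Prop :=
  exists B, B ∈ Gamma /\ forall x, x ∈ A <-> real x /\ ~ x ∈ B.

Definition in_Delta {V : setStructure} (Gamma A : V) : Prop :=
  A ∈ Gamma /\ in_dual Gamma A.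

Definition in_exists_real_Delta {V : setStructure} (Gamma A : V) : Prop :=
  exists B, in_Delta Gamma B /\ is_exists_real B A.

(* GC is the function (beta, gamma) |-> GC_{beta,gamma}. *)
Definition in_GC_at {V : setStructure} (GC beta gamma x : V) : Prop :=
  exists G, maps2 GC beta gamma G /\ x ∈ G.

Definition in_GC_row {V : setStructure} (kappa GC beta x : V) : Prop :=
  exists gamma, gamma ∈ kappa /\ in_GC_at GC beta gamma x.

Definition in_GC {V : setStructure} (kappa theta GC x : V) : Prop :=
  real x /\ forall beta, beta ∈ theta -> in_GC_row kappa GC beta x.

Record good_coding_system {V : setStructure}
    (kappa theta Gamma decode GC : V) : Prop := {
  gcs_regular : regular_cardinal kappa;
  gcs_ordinal : ordinal theta;
  gcs_le : ole theta kappa;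
  gcs_pointclass : pointclass Gamma;
  gcs_substitution : closed_continuous_substitution Gamma;
  gcs_exists : closed_exists_real Gamma;
  gcs_decode : exists RR Q P, is_reals RR /\ is_prod theta kappa Q /\
    is_power Q P /\ function decode RR P;
  gcs_decode_onto : forall f, function f theta kappa ->
    exists x, real x /\ maps decode x f;
  gcs_family : exists Q, is_prod theta kappa Q /\ function_on GC Q;
  gcs_Delta : forall beta gamma G, beta ∈ theta -> gamma ∈ kappa ->
    maps2 GC beta gamma G -> in_Delta Gamma G;
  gcs_GC : forall beta gamma x, beta ∈ theta -> gamma ∈ kappa -> real x ->
    (in_GC_at GC beta gamma x <->
     exists d, maps decode x d /\ pair_in beta gamma d /\
       forall gamma', gamma' ∈ kappa -> pair_in beta gamma' d ->
         gamma' = gamma);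
  gcs_boundedness : forall beta A, beta ∈ theta ->
    in_exists_real_Delta Gamma A ->
    (forall x, x ∈ A -> in_GC_row kappa GC beta x) ->
    exists delta, delta ∈ kappa /\
      forall x, x ∈ A -> exists gamma, gamma ∈ delta /\
        in_GC_at GC beta gamma x;
  gcs_unions : forall delta s U, delta ∈ kappa -> function_on s delta ->
    (forall a B, maps s a B -> in_Delta Gamma B) ->
    (forall x, x ∈ U <-> exists a B, maps s a B /\ x ∈ B) ->
    in_Delta Gamma U
}.

(* f is in [A]^delta. *)
Definition increasing {V : setStructure} (A delta f : V) : Prop :=
  function f delta A /\
  forall a b u v, a ∈ b -> maps f a u -> maps f b v -> u ∈ v.

Definition uniform_cofinality_omega {V : setStructure} (kappa delta f : V)
  : Prop :=
  exists w P g, is_omega w /\ is_prod delta w P /\ function g P kappa /\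
    (forall a m n u v, a ∈ delta -> n ∈ w -> m ∈ n ->
       maps2 g a m u -> maps2 g a n v -> u ∈ v) /\
    (forall a y, maps f a y ->
       is_sup (fun u => exists n, n ∈ w /\ maps2 g a n u) y).

Definition discontinuous_everywhere {V : setStructure} (delta f : V) : Prop :=
  forall a y, a ∈ delta -> maps f a y ->
    exists s, is_sup (fun u => exists b, b ∈ a /\ maps f b u) s /\ s ∈ y.

Definition correct_type {V : setStructure} (kappa delta f : V) : Prop :=
  uniform_cofinality_omega kappa delta f /\ discontinuous_everywhere delta f.

(* f is in [A]^delta_*, for A a subset of kappa. *)
Definition increasing_star {V : setStructure} (kappa A delta f : V) : Prop :=
  increasing A delta f /\ correct_type kappa delta f.

(* b = block(f), for f defined on omega * lam. *)
Definition is_block {V : setStructure} (lam f b : V) : Prop :=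
  function_on b lam /\
  forall a y, maps b a y ->
    is_sup (fun u => exists m k i,
      is_omega_mul a m /\ natural k /\ is_add m k i /\ maps f i u) y.

(* Main.v *)
(* Players I and II build reals x and (y, z); I must keep x, and II must keep y,
   inside GC_0, GC_1, ..., the first to fail losing, and otherwise II wins iff z
   uniformizes R at the function h whose values are the suprema of the blocks of
   decode(x) and decode(y) taken together (or h is not in dom(R)).  The runs that
   follow a fixed strategy form a Delta set, so boundedness yields a club C such
   that, when the opponent plays a code of f in [C]^(omega * lambda), the
   strategy's own function g satisfies g(beta) < f(beta + 1); the blocks of f and
   g then have the same suprema, and h = block(f).  Hence a strategy for I is
   defeated by a code of some f in [C]^(omega * lambda) together with a z in
   R(block(f)), and from a strategy for II one reads off F(x) = z.

   The ambient model need not be well founded, so recursion and induction are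
   available for definable classes only. *)
Require Import Defs.
From Stdlib Require Import ssreflect Classical ClassicalEpsilon Arith.

Set Bullet Behavior "None".

(** * Definable classes *)

(** The answers of the strategy to opponents whose rows through beta have values at most delta form
    a projection of a Delta set, contained in GC_beta by the rule on failing; hence some eta(beta,
    delta) < kappa bounds their values. C consists of the ordinals closed under eta. As beta <=
    f(beta) < f(beta + 1), both beta and f(beta) lie below the closure point f(beta + 1), and so
    does g(beta). Suprema over blocks do not see the shift by one, and pooling both players' values
    makes the estimate usable whichever player owns the strategy.

    Gamma is known only by its closure properties and by the sets GC_{beta,gamma}. Even clopen sets
    have to be traced back to such a set, which takes a nonempty theta, and a closed set is an
    intersection of omega clopen ones, which takes omega < kappa. So the cases theta empty and kappa
    = omega are separate: in the first there is at most one block function, in the second no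
    nonempty function of correct type. *)

Definition up (r : nat -> nat) (n : nat) : nat :=
  match n with O => O | S m => S (r m) end.

Fixpoint rename (r : nat -> nat) (p : formula) : formula :=
  match p with
  | FMem i j => FMem (r i) (r j)
  | FEq i j => FEq (r i) (r j)
  | FBot => FBot
  | FImp p q => FImp (rename r p) (rename r q)
  | FAnd p q => FAnd (rename r p) (rename r q)
  | FOr p q => FOr (rename r p) (rename r q)
  | FAll p => FAll (rename (up r) p)
  | FEx p => FEx (rename (up r) p)
  end.

Lemma sat_ext {V : setStructure} p : forall e e' : nat -> V,
  (forall n, e n = e' n) -> sat e p <-> sat e' p.
Proof.
elim: p => [i j|i j||p IHp q IHq|p IHp q IHq|p IHp q IHq|p IHp|p IHp] e e' E /=.
- by rewrite !E.
- by rewrite !E.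
- by [].
- by rewrite (IHp _ _ E) (IHq _ _ E).
- by rewrite (IHp _ _ E) (IHq _ _ E).
- by rewrite (IHp _ _ E) (IHq _ _ E).
- have H a : sat (scons a e) p <-> sat (scons a e') p by apply: IHp => - [|n] /=.
  by split=> h a; apply/H.
- have H a : sat (scons a e) p <-> sat (scons a e') p by apply: IHp => - [|n] /=.
  by split=> - [a h]; exists a; apply/H.
Qed.

Lemma sat_rename {V : setStructure} p : forall r (e : nat -> V),
  sat e (rename r p) <-> sat (fun n => e (r n)) p.
Proof.
elim: p => [i j|i j||p IHp q IHq|p IHp q IHq|p IHp q IHq|p IHp|p IHp] r e //=.
- by rewrite IHp IHq.
- by rewrite IHp IHq.
- by rewrite IHp IHq.
- have H a : sat (scons a e) (rename (up r) p)
             <-> sat (scons a (fun n => e (r n))) p.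
    by rewrite IHp; apply: sat_ext => - [|n].
  by split=> h a; apply/H.
- have H a : sat (scons a e) (rename (up r) p)
             <-> sat (scons a (fun n => e (r n))) p.
    by rewrite IHp; apply: sat_ext => - [|n].
  by split=> - [a h]; exists a; apply/H.
Qed.

Definition look {V : setStructure} (e : nat -> V) (t : nat + V) : V :=
  match t with inl i => e i | inr v => v end.

(* [def P]: the class [P] of environments is given by a formula, each of whose
   free variables stands for an entry of the environment or for a parameter. *)
Definition def {V : setStructure} (P : (nat -> V) -> Prop) : Prop :=
  exists p k, forall e, P e <-> sat (fun n => look e (k n)) p.

(** Entry 0 holds the value and the entries from 1 on form the environment of the term. This is the
    layout that [def_ex] expects when a term is replaced by a quantified variable equal to it. *)
Definition tm {V : setStructure} (t : (nat -> V) -> V) : Prop :=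
  def (fun e => e 0 = t (fun n => e (S n))).

Definition def1 {V : setStructure} (P : V -> Prop) : Prop :=
  def (fun e => P (e 0)).
Definition def2 {V : setStructure} (P : V -> V -> Prop) : Prop :=
  def (fun e => P (e 0) (e 1)).
Definition def3 {V : setStructure} (P : V -> V -> V -> Prop) : Prop :=
  def (fun e => P (e 0) (e 1) (e 2)).
Definition def4 {V : setStructure} (P : V -> V -> V -> V -> Prop) : Prop :=
  def (fun e => P (e 0) (e 1) (e 2) (e 3)).
Definition fdef1 {V : setStructure} (F : V -> V) : Prop :=
  def2 (fun y a => y = F a).
Definition fdef2 {V : setStructure} (F : V -> V -> V) : Prop :=
  def3 (fun y a b => y = F a b).

Section Definability.
Context {V : setStructure}.
Implicit Types (P Q : (nat -> V) -> Prop) (t u : (nat -> V) -> V).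

Lemma def_ext P Q : (forall e, P e <-> Q e) -> def P -> def Q.
Proof. by move=> E [p [k H]]; exists p, k => e; rewrite -E. Qed.

Lemma def_rename (r : nat -> nat) P : def P -> def (fun e => P (fun n => e (r n))).
Proof.
move=> [p [k H]].
exists p, (fun n => match k n with inl i => inl (r i) | inr v => inr v end) => e.
by rewrite H; apply: sat_ext => n; case: (k n).
Qed.

(** Two formulas come with unrelated assignments of their variables. Moving the first to the even
    variables and the second to the odd ones lets one assignment serve both. *)
Definition interleave (k l : nat -> nat + V) (n : nat) : nat + V :=
  if Nat.even n then k (Nat.div2 n) else l (Nat.div2 n).

Lemma def_op (op : formula -> formula -> formula) (o : Prop -> Prop -> Prop) P Q :
  (forall (e : nat -> V) p q, sat e (op p q) <-> o (sat e p) (sat e q)) ->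
  (forall A A' B B', (A <-> A') -> (B <-> B') -> (o A B <-> o A' B')) ->
  def P -> def Q -> def (fun e => o (P e) (Q e)).
Proof.
move=> Hop Ho [p [k Hp]] [q [l Hq]].
exists (op (rename (fun n => 2 * n) p) (rename (fun n => 2 * n + 1) q)),
  (interleave k l) => e.
rewrite Hop; apply: Ho.
- rewrite Hp sat_rename; apply: sat_ext => n.
  by rewrite /interleave Nat.div2_double Nat.even_mul.
- rewrite Hq sat_rename; apply: sat_ext => n; rewrite /interleave.
  by rewrite Nat.add_1_r Nat.even_succ Nat.odd_mul Nat.div2_succ_double.
Qed.

Lemma def_and P Q : def P -> def Q -> def (fun e => P e /\ Q e).
Proof. by apply: (def_op FAnd and) => //; tauto. Qed.

Lemma def_or P Q : def P -> def Q -> def (fun e => P e \/ Q e).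
Proof. by apply: (def_op FOr or) => //; tauto. Qed.

Lemma def_imp P Q : def P -> def Q -> def (fun e => P e -> Q e).
Proof. by apply: (def_op FImp (fun A B => A -> B)) => //; tauto. Qed.

Lemma def_iff P Q : def P -> def Q -> def (fun e => P e <-> Q e).
Proof. by move=> dP dQ; apply: def_and; apply: def_imp. Qed.

Lemma def_False : def (fun _ : nat -> V => False).
Proof. by exists FBot, (fun n => inl n). Qed.

Lemma def_not P : def P -> def (fun e => ~ P e).
Proof. by move=> dP; apply: def_imp => //; apply: def_False. Qed.

(** Several variables of the formula may stand for entry 0. All of them are renamed to the bound
    variable, the others move up by one; the value that the new assignment keeps for the former is
    never read. *)
Lemma def_quant (q : formula -> formula) (Q : (V -> Prop) -> Prop)
    (P : V -> (nat -> V) -> Prop) :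
  (forall (e : nat -> V) p, sat e (q p) <-> Q (fun a => sat (scons a e) p)) ->
  (forall A B : V -> Prop, (forall a, A a <-> B a) -> (Q A <-> Q B)) ->
  def (fun e => P (e 0) (fun n => e (S n))) -> def (fun e => Q (fun a => P a e)).
Proof.
move=> Hq HQ [p [k H]].
exists (q (rename (fun n => match k n with inl 0 => 0 | _ => S n end) p)),
  (fun n => match k n with inl (S i) => inl i | c => c end) => e.
rewrite Hq; apply: HQ => a; rewrite sat_rename.
rewrite (H (scons a e)); apply: sat_ext => n.
by case E : (k n) => [[|i]|v] //=; rewrite E.
Qed.

Lemma def_ex (P : V -> (nat -> V) -> Prop) :
  def (fun e => P (e 0) (fun n => e (S n))) -> def (fun e => exists a, P a e).
Proof.
apply: (def_quant FEx (fun A => exists a, A a)) => // A B E.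
by split=> - [a h]; exists a; apply/E.
Qed.

Lemma def_all (P : V -> (nat -> V) -> Prop) :
  def (fun e => P (e 0) (fun n => e (S n))) -> def (fun e => forall a, P a e).
Proof.
apply: (def_quant FAll (fun A => forall a, A a)) => // A B E.
by split=> h a; apply/E.
Qed.

Lemma tm_var i : tm (fun e : nat -> V => e i).
Proof.
by exists (FEq 0 1), (fun n => match n with 0 => inl 0 | _ => inl (S i) end).
Qed.

Lemma tm_const (c : V) : tm (fun _ => c).
Proof.
by exists (FEq 0 1), (fun n => match n with 0 => inl 0 | _ => inr c end).
Qed.

Lemma tm_lift t : tm t -> tm (fun e => t (fun n => e (S n))).
Proof.
exact: (def_rename (fun n => match n with 0 => 0 | S m => S (S m) end)).
Qed.

Lemma def_app1 (H : V -> Prop) t : def1 H -> tm t -> def (fun e => H (t e)).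
Proof.
move=> dH dt; apply: (def_ext (fun e => exists a, a = t e /\ H a)).
  by move=> e; split=> [[a [-> h]]|h] //; exists (t e).
by apply: def_ex; apply: def_and.
Qed.

(** Terms are substituted one at a time by quantifying over their values. The nested quantifiers
    list the values in reverse order, and the closing renaming undoes this. *)
Lemma def_app2 (H : V -> V -> Prop) t u :
  def2 H -> tm t -> tm u -> def (fun e => H (t e) (u e)).
Proof.
move=> dH dt du; apply: (def_ext (fun e => exists a, a = t e /\ H a (u e))).
  by move=> e; split=> [[a [-> h]]|h] //; exists (t e).
apply: def_ex; apply: def_and => //.
apply: (def_ext (fun e => exists b, b = u (fun n => e (S n)) /\ H (e 0) b)).
  move=> e; split=> [[a [-> h]]|h] //; by exists (u (fun n => e (S n))).
apply: def_ex; apply: def_and; first exact: tm_lift.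
exact: (def_rename (fun n => match n with 0 => 1 | _ => 0 end) _ dH).
Qed.

Lemma def_app3 (H : V -> V -> V -> Prop) t u v :
  def3 H -> tm t -> tm u -> tm v -> def (fun e => H (t e) (u e) (v e)).
Proof.
move=> dH dt du dv.
apply: (def_ext (fun e => exists a, a = t e /\ H a (u e) (v e))).
  by move=> e; split=> [[a [-> h]]|h] //; exists (t e).
apply: def_ex; apply: def_and => //.
apply: (def_ext (fun e => exists b, b = u (fun n => e (S n)) /\
  H (e 0) b (v (fun n => e (S n))))).
  move=> e; split=> [[a [-> h]]|h] //; by exists (u (fun n => e (S n))).
apply: def_ex; apply: def_and; first exact: tm_lift.
apply: (def_ext (fun e => exists b, b = v (fun n => e (S (S n))) /\
  H (e 1) (e 0) b)).
  move=> e; split=> [[a [-> h]]|h] //; by exists (v (fun n => e (S (S n)))).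
apply: def_ex; apply: def_and; first exact: (tm_lift _ (tm_lift _ dv)).
exact: (def_rename (fun n => match n with 0 => 2 | 1 => 1 | _ => 0 end) _ dH).
Qed.

Lemma def_app4 (H : V -> V -> V -> V -> Prop) t u v w :
  def4 H -> tm t -> tm u -> tm v -> tm w ->
  def (fun e => H (t e) (u e) (v e) (w e)).
Proof.
move=> dH dt du dv dw.
apply: (def_ext (fun e => exists a, a = t e /\ H a (u e) (v e) (w e))).
  by move=> e; split=> [[a [-> h]]|h] //; exists (t e).
apply: def_ex; apply: def_and => //.
apply: (def_ext (fun e => exists b, b = u (fun n => e (S n)) /\
  H (e 0) b (v (fun n => e (S n))) (w (fun n => e (S n))))).
  move=> e; split=> [[a [-> h]]|h] //; by exists (u (fun n => e (S n))).
apply: def_ex; apply: def_and; first exact: tm_lift.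
apply: (def_ext (fun e => exists b, b = v (fun n => e (S (S n))) /\
  H (e 1) (e 0) b (w (fun n => e (S (S n)))))).
  move=> e; split=> [[a [-> h]]|h] //; by exists (v (fun n => e (S (S n)))).
apply: def_ex; apply: def_and; first exact: (tm_lift _ (tm_lift _ dv)).
apply: (def_ext (fun e => exists b, b = w (fun n => e (S (S (S n)))) /\
  H (e 2) (e 1) (e 0) b)).
  move=> e; split=> [[a [-> h]]|h] //; by exists (w (fun n => e (S (S (S n))))).
apply: def_ex; apply: def_and; first exact: (tm_lift _ (tm_lift _ (tm_lift _ dw))).
exact: (def_rename
  (fun n => match n with 0 => 3 | 1 => 2 | 2 => 1 | _ => 0 end) _ dH).
Qed.

Lemma tm_app1 (F : V -> V) t : fdef1 F -> tm t -> tm (fun e => F (t e)).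
Proof.
move=> dF dt.
apply: (def_app2 (fun y a => y = F a) (fun e => e 0)) => //; first exact: tm_var.
exact: tm_lift.
Qed.

Lemma tm_app2 (F : V -> V -> V) t u :
  fdef2 F -> tm t -> tm u -> tm (fun e => F (t e) (u e)).
Proof.
move=> dF dt du.
apply: (def_app3 (fun y a b => y = F a b) (fun e => e 0)) => //.
- exact: tm_var.
- exact: tm_lift.
- exact: tm_lift.
Qed.

Lemma def_mem : def2 (@mem V).
Proof. by exists (FMem 0 1), (fun n => inl n). Qed.

Lemma def_eq : def2 (@eq V).
Proof. by exists (FEq 0 1), (fun n => inl n). Qed.

End Definability.

(* Automation of definability proofs *)
Create HintDb defs.
#[global] Hint Resolve def_mem def_eq : defs.

Ltac dtm :=
  cbv beta;
  first
  [ apply tm_const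
  | apply tm_var
  | match goal with
    | |- tm (fun e => ?F (@?t e) (@?u e)) =>
        apply (tm_app2 F t u); [solve [auto with nocore defs] | dtm | dtm]
    end
  | match goal with
    | |- tm (fun e => ?F (@?t e)) =>
        apply (tm_app1 F t); [solve [auto with nocore defs] | dtm]
    end ].

(** Separation, induction and recursion in V each leave a side goal that a class is definable. The
    tactic follows the syntax of the class down to atoms registered in [defs], and leaves open what
    it does not recognize. *)
Ltac dtac :=
  cbv beta;
  lazymatch goal with
  | |- def (fun e => _ /\ _) => apply def_and; dtac
  | |- def (fun e => _ \/ _) => apply def_or; dtac
  | |- def (fun e => _ <-> _) => apply def_iff; dtac
  | |- def (fun e => ~ _) => apply def_not; dtac
  | |- def (fun e => False) => apply def_False
  | |- def (fun e => exists! x, _) => unfold unique; dtac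
  | |- def (fun e => exists x, _) => apply def_ex; dtac
  | |- def (fun e => (@?A e) -> (@?B e)) => apply (def_imp A B); dtac
  | |- def (fun e => forall x, _) => apply def_all; dtac
  | |- def (fun e => ?t) =>
    first
    [ match goal with
      | |- def (fun e => ?H (@?t e) (@?u e) (@?v e) (@?w e)) =>
        apply (def_app4 H t u v w);
          [solve [auto with nocore defs] | dtm | dtm | dtm | dtm]
      end
    | match goal with
      | |- def (fun e => ?H (@?t e) (@?u e) (@?v e)) =>
        apply (def_app3 H t u v);
          [solve [auto with nocore defs] | dtm | dtm | dtm]
      end
    | match goal with
      | |- def (fun e => ?H (@?t e) (@?u e)) =>
        apply (def_app2 H t u); [solve [auto with nocore defs] | dtm | dtm]
      end
    | match goal with
      | |- def (fun e => ?H (@?t e)) =>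
        apply (def_app1 H t); [solve [auto with nocore defs] | dtm]
      end
    | idtac ]
  | |- def1 _ => unfold def1; dtac
  | |- def2 _ => unfold def2; dtac
  | |- def3 _ => unfold def3; dtac
  | |- def4 _ => unfold def4; dtac
  | |- fdef1 _ => unfold fdef1; dtac
  | |- fdef2 _ => unfold fdef2; dtac
  | |- _ => idtac
  end.

(** * Definability of the set-theoretic notions of the statement *)

Section DefinableNotions.
Context {V : setStructure}.

Lemma def_is_empty : def1 (@is_empty V).
Proof. unfold is_empty; dtac. Qed.
Hint Resolve def_is_empty : defs.
Lemma def_subset : def2 (@subset V).
Proof. unfold subset; dtac. Qed.
Hint Resolve def_subset : defs.
Lemma def_is_succ : def2 (@is_succ V).
Proof. unfold is_succ; dtac. Qed.
Hint Resolve def_is_succ : defs.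
Lemma def_is_upair : def3 (@is_upair V).
Proof. unfold is_upair; dtac. Qed.
Hint Resolve def_is_upair : defs.
Lemma def_is_opair : def3 (@is_opair V).
Proof. unfold is_opair; dtac. Qed.
Hint Resolve def_is_opair : defs.
Lemma def_pair_in : def3 (@pair_in V).
Proof. unfold pair_in; dtac. Qed.
Hint Resolve def_pair_in : defs.
Lemma def_maps2 : def4 (@maps2 V).
Proof. unfold maps2; dtac. Qed.
Hint Resolve def_maps2 : defs.
Lemma def_function_on : def2 (@function_on V).
Proof. unfold function_on; dtac. Qed.
Hint Resolve def_function_on : defs.
Lemma def_function : def3 (@function V).
Proof. unfold function; dtac. Qed.
Hint Resolve def_function : defs.
Lemma def_transitive : def1 (@transitive V).
Proof. unfold transitive; dtac. Qed.
Hint Resolve def_transitive : defs.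
Lemma def_ordinal : def1 (@ordinal V).
Proof. unfold ordinal; dtac. Qed.
Hint Resolve def_ordinal : defs.
Lemma def_ole : def2 (@ole V).
Proof. unfold ole; dtac. Qed.
Hint Resolve def_ole : defs.
Lemma def_limit : def1 (@limit V).
Proof. unfold limit; dtac. Qed.
Hint Resolve def_limit : defs.
Lemma def_natural : def1 (@natural V).
Proof. unfold natural; dtac. Qed.
Hint Resolve def_natural : defs.
Lemma def_is_omega : def1 (@is_omega V).
Proof. unfold is_omega; dtac. Qed.
Hint Resolve def_is_omega : defs.
Lemma def_is_add : def3 (@is_add V).
Proof. unfold is_add, is_sup; dtac. Qed.
Hint Resolve def_is_add : defs.
Lemma def_is_mul : def3 (@is_mul V).
Proof. unfold is_mul, is_sup; dtac. Qed.
Hint Resolve def_is_mul : defs.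
Lemma def_is_omega_mul : def2 (@is_omega_mul V).
Proof. unfold is_omega_mul; dtac. Qed.
Hint Resolve def_is_omega_mul : defs.
Lemma def_even : def1 (@even V).
Proof. unfold even, double; dtac. Qed.
Hint Resolve def_even : defs.
Lemma def_odd : def1 (@odd V).
Proof. unfold odd; dtac. Qed.
Lemma def_is_restriction : def3 (@is_restriction V).
Proof. unfold is_restriction; dtac. Qed.
Lemma def_real : def1 (@real V).
Proof. unfold real; dtac. Qed.
Lemma def_in_GC_at : def4 (@in_GC_at V).
Proof. unfold in_GC_at; dtac. Qed.
End DefinableNotions.

#[global] Hint Resolve def_is_empty def_subset def_is_succ def_is_upair
  def_is_opair def_pair_in def_maps2 def_function_on def_function
  def_transitive def_ordinal def_ole def_limit def_natural def_is_omega
  def_is_add def_is_mul def_is_omega_mul def_even def_odd def_is_restriction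
  def_real def_in_GC_at : defs.

(** * Elementary set theory in a model of ZF *)

Section SetTheory.
Context {V : setStructure} (hZF : ZF V).
Implicit Types (a b c x y z f g h A B p : V).

Lemma set_ext x y : (forall z, z ∈ x <-> z ∈ y) -> x = y.
Proof. exact: ZF_extensionality. Qed.

Lemma separation (P : V -> Prop) A :
  def1 P -> exists B, forall x, x ∈ B <-> x ∈ A /\ P x.
Proof.
move=> [p [k H]].
(* [P] depends on entry 0 only, so the remaining entries may be anything; [A] fills them. *)
have [B HB] := ZF_separation _ hZF
  (rename (fun n => match k n with inl 0 => 0 | _ => S n end) p)
  (fun n => match k n with inl (S i) => A | inl 0 => A | inr v => v end) A.
exists B => x; rewrite HB sat_rename (H (fun n => match n with 0 => x | _ => A end)).
split=> - [h1 h2]; split=> //; move: h2; apply sat_ext => n;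
  by case E : (k n) => [[|i]|v] //=; rewrite ?E.
Qed.

(** The ambient [epsilon] only names a set that Extensionality makes unique, so no choice principle
    enters V. The term is meaningful when [P] is definable. *)
Definition sep A (P : V -> Prop) : V :=
  epsilon (inhabits A) (fun B => forall x, x ∈ B <-> x ∈ A /\ P x).

Lemma in_sep P A : def1 P -> forall x, x ∈ sep A P <-> x ∈ A /\ P x.
Proof.
move=> dP; apply: (epsilon_spec (inhabits A)
  (fun B => forall x, x ∈ B <-> x ∈ A /\ P x)).
exact: separation.
Qed.

Lemma ex_upair a b : { p | is_upair a b p }.
Proof. by apply: constructive_indefinite_description; apply: ZF_pairing. Qed.
Definition upair a b : V := proj1_sig (ex_upair a b).
Lemma in_upair a b x : x ∈ upair a b <-> x = a \/ x = b.
Proof. exact: (proj2_sig (ex_upair a b)). Qed.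

Lemma ex_union a : { U | is_union a U }.
Proof. by apply: constructive_indefinite_description; apply: ZF_union. Qed.
Definition union a : V := proj1_sig (ex_union a).
Lemma in_union a x : x ∈ union a <-> exists y, y ∈ a /\ x ∈ y.
Proof. exact: (proj2_sig (ex_union a)). Qed.

Lemma ex_power a : { U | is_power a U }.
Proof. by apply: constructive_indefinite_description; apply: ZF_power. Qed.
Definition power a : V := proj1_sig (ex_power a).
Lemma in_power a x : x ∈ power a <-> subset x a.
Proof. exact: (proj2_sig (ex_power a)). Qed.

Lemma ex_emp : { o : V | is_empty o }.
Proof.
apply: constructive_indefinite_description.
by have [I [[o [ho _]] _]] := ZF_infinity _ hZF; exists o.
Qed.
Definition emp : V := proj1_sig ex_emp.
Lemma in_emp x : ~ x ∈ emp.
Proof. exact: (proj2_sig ex_emp). Qed.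
Lemma is_emptyE x : is_empty x <-> x = emp.
Proof.
split=> [h|->]; last exact: in_emp.
by apply: set_ext => z; split=> [/h|/in_emp].
Qed.

Definition cup a b : V := union (upair a b).
Lemma in_cup a b x : x ∈ cup a b <-> x ∈ a \/ x ∈ b.
Proof.
rewrite in_union; split=> [[y [/in_upair [->|->]]]|]; try tauto.
by case=> h; [exists a|exists b]; split=> //; apply/in_upair; tauto.
Qed.

Definition suc a : V := cup a (upair a a).
Lemma in_suc a x : x ∈ suc a <-> x ∈ a \/ x = a.
Proof. rewrite in_cup in_upair; tauto. Qed.
Lemma is_succE a s : is_succ a s <-> s = suc a.
Proof.
split=> [h|-> z]; last exact: in_suc.
by apply: set_ext => z; rewrite h in_suc.
Qed.
Lemma in_suc_self a : a ∈ suc a.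
Proof. by apply/in_suc; right. Qed.

Lemma is_upairE a b p : is_upair a b p <-> p = upair a b.
Proof.
split=> [h|-> z]; last exact: in_upair.
by apply: set_ext => z; rewrite h in_upair.
Qed.

Definition opair a b : V := upair (upair a a) (upair a b).
Lemma is_opairE a b p : is_opair a b p <-> p = opair a b.
Proof.
split=> [[u [v [/is_upairE -> [/is_upairE -> /is_upairE ->]]]]|->] //.
by exists (upair a a), (upair a b); rewrite !is_upairE.
Qed.

Lemma upair_inj a b c d : upair a b = upair c d ->
  (a = c /\ b = d) \/ (a = d /\ b = c).
Proof.
move=> E.
have ha : a ∈ upair c d by rewrite -E; apply/in_upair; left.
have hb : b ∈ upair c d by rewrite -E; apply/in_upair; right.
have hc : c ∈ upair a b by rewrite E; apply/in_upair; left.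
have hd : d ∈ upair a b by rewrite E; apply/in_upair; right.
move: ha hb hc hd; rewrite !in_upair; intuition congruence.
Qed.

Lemma opair_inj a b c d : opair a b = opair c d -> a = c /\ b = d.
Proof.
by case/upair_inj=> - [/upair_inj h1 /upair_inj h2]; intuition congruence.
Qed.

Lemma mapsE f a b : maps f a b <-> opair a b ∈ f.
Proof.
split=> [[p [/is_opairE -> h]]|h] //.
by exists (opair a b); rewrite is_opairE.
Qed.

Lemma fdef_by (F : V -> V) (P : V -> V -> Prop) :
  (forall y a, y = F a <-> P y a) -> def2 P -> fdef1 F.
Proof. by move=> E; apply: def_ext => e; rewrite E. Qed.
Lemma fdef2_by (F : V -> V -> V) (P : V -> V -> V -> Prop) :
  (forall y a b, y = F a b <-> P y a b) -> def3 P -> fdef2 F.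
Proof. by move=> E; apply: def_ext => e; rewrite E. Qed.

Lemma def_suc : fdef1 suc.
Proof.
apply: (fdef_by _ (fun y a => is_succ a y)); last dtac.
by move=> y a; rewrite is_succE.
Qed.
Lemma def_opair : fdef2 opair.
Proof.
apply: (fdef2_by _ (fun y a b => is_opair a b y)); last dtac.
by move=> y a b; rewrite is_opairE.
Qed.
#[local] Hint Resolve def_suc def_opair : defs.

Definition prod A B : V :=
  sep (power (power (cup A B)))
    (fun p => exists a b, a ∈ A /\ b ∈ B /\ p = opair a b).
Lemma in_prod A B p : p ∈ prod A B <-> exists a b, a ∈ A /\ b ∈ B /\ p = opair a b.
Proof.
rewrite in_sep; first by dtac.
split=> [[]|[a [b [ha [hb ->]]]]] //; split; last by exists a, b.
apply/in_power => z hz; apply/in_power => u hu; apply/in_cup.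
by move: hz hu; rewrite in_upair => - [] ->; rewrite in_upair => - [] ->; tauto.
Qed.
Lemma is_prodE A B P : is_prod A B P <-> P = prod A B.
Proof.
have H p : p ∈ prod A B <-> exists a b, a ∈ A /\ b ∈ B /\ is_opair a b p.
  rewrite in_prod; split=> - [a [b [ha [hb hp]]]]; exists a, b;
    by rewrite is_opairE in hp *.
split=> [h|-> p]; last exact: H.
by apply: set_ext => z; rewrite h H.
Qed.

Definition graph A B (P : V -> V -> Prop) : V :=
  sep (prod A B) (fun p => exists a b, p = opair a b /\ P a b).

Lemma maps_graph A B P : def2 P ->
  forall a b, maps (graph A B P) a b <-> a ∈ A /\ b ∈ B /\ P a b.
Proof.
move=> dP a b; rewrite mapsE in_sep; first by dtac.
rewrite in_prod; split.
  case=> - [a' [b' [ha [hb E]]]] [a'' [b'' [E' h]]].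
  case/opair_inj: E ha hb => <- <- ha hb.
  by case/opair_inj: E' h => <- <-.
by case=> ha [hb h]; split; exists a, b.
Qed.

Lemma graph_function A B P : def2 P ->
  (forall a, a ∈ A -> exists b, b ∈ B /\ P a b) ->
  (forall a b b', a ∈ A -> P a b -> P a b' -> b = b') ->
  function (graph A B P) A B.
Proof.
move=> dP ex un; split; last by move=> a b /(maps_graph A B P dP) [_ []].
split=> [p|a ha].
  rewrite in_sep; first by dtac.
  by case=> /in_prod [a [b [ha [_ ->]]]] _; exists a, b; rewrite is_opairE.
have [b [hb h]] := ex _ ha; exists b; split; first by apply/maps_graph.
by move=> b' /(maps_graph A B P dP) [_ [_ h']]; apply: un h h'.
Qed.

(** The union of all values of [f] at [x]: a total definable operation that returns the value when
    there is exactly one. With Kuratowski pairs, the elements of a value lie three unions below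
    [f]. *)
Definition ap f x : V :=
  sep (union (union (union f))) (fun z => exists v, maps f x v /\ z ∈ v).

Lemma in_ap f x z : z ∈ ap f x <-> exists v, maps f x v /\ z ∈ v.
Proof.
rewrite in_sep; first by dtac.
split=> [[]|[v [h hz]]] //; split; last by exists v.
apply/in_union; exists v; split=> //; apply/in_union; exists (upair x v).
split; last by apply/in_upair; right.
apply/in_union; exists (opair x v); split; first by apply/mapsE.
by apply/in_upair; right.
Qed.

Lemma def_ap : fdef2 ap.
Proof.
apply: (fdef2_by _ (fun y f x => forall z, z ∈ y <-> exists v, maps f x v /\ z ∈ v));
  last by dtac.
move=> y f x; split=> [-> z|h]; first exact: in_ap.
by apply: set_ext => z; rewrite in_ap h.
Qed.
#[local] Hint Resolve def_ap : defs.

Lemma maps_apE f A a b : function_on f A -> maps f a b <-> a ∈ A /\ b = ap f a.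
Proof.
move=> [h1 h2].
have dom a' b' : maps f a' b' -> a' ∈ A.
  move=> /mapsE /h1 [a1 [b1 [ha /is_opairE E]]].
  by move/opair_inj: E => [-> _].
have val a' b' : maps f a' b' -> ap f a' = b'.
  move=> h; have [c [_ hc]] := h2 _ (dom _ _ h).
  apply: set_ext => z; rewrite in_ap; split=> [[v [hv hz]]|hz]; last by exists b'.
  by rewrite -(hc _ h) (hc _ hv).
split=> [h|[ha ->]]; first by split; [apply: dom h|rewrite (val _ _ h)].
by have [c [hc _]] := h2 _ ha; rewrite (val _ _ hc).
Qed.

Lemma maps_ap f A a : function_on f A -> a ∈ A -> maps f a (ap f a).
Proof. by move=> hf ha; apply/(maps_apE _ _ _ _ hf). Qed.
Lemma maps_val f A a b : function_on f A -> maps f a b -> b = ap f a.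
Proof. by move=> hf /(maps_apE _ _ _ _ hf) []. Qed.
Lemma maps_dom f A a b : function_on f A -> maps f a b -> a ∈ A.
Proof. by move=> hf /(maps_apE _ _ _ _ hf) []. Qed.
Lemma ap_in f A B a : function f A B -> a ∈ A -> ap f a ∈ B.
Proof. by move=> [hf hB] ha; apply: (hB a); apply: maps_ap hf ha. Qed.

Lemma function_opair f A p : function_on f A -> p ∈ f ->
  exists a, a ∈ A /\ p = opair a (ap f a).
Proof.
move=> hf hp; have [a [b [ha /is_opairE E]]] := proj1 hf _ hp.
exists a; split=> //; rewrite E; congr opair; apply: (maps_val _ _ _ _ hf).
by apply/mapsE; rewrite -E.
Qed.

Lemma fun_ext f g A : function_on f A -> function_on g A ->
  (forall a, a ∈ A -> ap f a = ap g a) -> f = g.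
Proof.
move=> hf hg E; apply: set_ext => p.
split=> hp.
  have [a [ha ->]] := function_opair _ _ _ hf hp.
  by rewrite E //; apply/mapsE; apply: maps_ap hg ha.
have [a [ha ->]] := function_opair _ _ _ hg hp.
by rewrite -E //; apply/mapsE; apply: maps_ap hf ha.
Qed.

Lemma function_weaken f A B B' : function f A B -> subset B B' -> function f A B'.
Proof. by move=> [h1 h2] s; split=> // a b /h2 /s. Qed.

Definition lam A B (F : V -> V) : V := graph A B (fun a b => b = F a).

Lemma lam_function A B F : fdef1 F -> (forall a, a ∈ A -> F a ∈ B) ->
  function (lam A B F) A B.
Proof.
move=> dF h; apply: graph_function; first by dtac.
  by move=> a ha; exists (F a); split=> //; apply: h.
by move=> a b b' _ -> ->.
Qed.

Lemma ap_lam A B F a : fdef1 F -> (forall a, a ∈ A -> F a ∈ B) -> a ∈ A ->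
  ap (lam A B F) a = F a.
Proof.
move=> dF h ha; have [hf _] := lam_function _ _ _ dF h.
have := maps_ap _ _ _ hf ha.
rewrite maps_graph; first by dtac.
by case=> _ [].
Qed.

Lemma graph_ap A B P a : def2 P ->
  (forall a, a ∈ A -> exists b, b ∈ B /\ P a b) ->
  (forall a b b', a ∈ A -> P a b -> P a b' -> b = b') ->
  a ∈ A -> P a (ap (graph A B P) a).
Proof.
move=> dP ex un ha; have [hf _] := graph_function _ _ _ dP ex un.
by have := maps_ap _ _ _ hf ha; rewrite maps_graph // => - [_ []].
Qed.

Definition restr f A : V := sep f (fun p => exists a b, a ∈ A /\ p = opair a b).

Lemma in_restr f A p : p ∈ restr f A <-> p ∈ f /\ exists a b, a ∈ A /\ p = opair a b.
Proof. by apply: in_sep; dtac. Qed.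

Lemma is_restrictionE f A r : is_restriction f A r <-> r = restr f A.
Proof.
have H p : p ∈ restr f A <-> p ∈ f /\ exists a b, a ∈ A /\ is_opair a b p.
  rewrite in_restr; split=> - [h [a [b [ha hp]]]]; split=> //; exists a, b;
    by rewrite is_opairE in hp *.
split=> [h|-> p]; last exact: H.
by apply: set_ext => z; rewrite h H.
Qed.

Lemma def_restr : fdef2 restr.
Proof.
apply: (fdef2_by _ (fun y f x => is_restriction f x y)); last by dtac.
by move=> y f x; rewrite is_restrictionE.
Qed.

Lemma maps_restr f A a b : maps (restr f A) a b <-> a ∈ A /\ maps f a b.
Proof.
rewrite !mapsE in_restr; split=> [[h [a' [b' [ha E]]]]|[ha h]].
  by case/opair_inj: E ha => <-.
by split=> //; exists a, b.
Qed.

Lemma restr_function f A B C : function f A B -> subset C A ->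
  function (restr f C) C B.
Proof.
move=> [hf hB] s; split; last by move=> a b /maps_restr [_ /hB].
split=> [p /in_restr [_ [a [b [ha ->]]]]|a ha].
  by exists a, b; rewrite is_opairE.
exists (ap f a); split.
  by apply/maps_restr; split=> //; apply: maps_ap hf (s _ ha).
by move=> b /maps_restr [_ h]; rewrite (maps_val _ _ _ _ hf h).
Qed.

Lemma ap_restr f A B C a : function f A B -> subset C A -> a ∈ C ->
  ap (restr f C) a = ap f a.
Proof.
move=> hf s ha; symmetry; apply: (maps_val _ C).
  exact: (proj1 (restr_function _ _ _ _ hf s)).
by apply/maps_restr; split=> //; apply: maps_ap (proj1 hf) (s _ ha).
Qed.

(** * Ordinals *)

Lemma mem_irrefl x : ~ x ∈ x.
Proof.
move=> h; have [|y [hy hm]] := ZF_foundation _ hZF (upair x x).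
  by exists x; apply/in_upair; left.
have E : y = x by move/in_upair: hy => [].
by subst y; apply: (hm x) => //; apply/in_upair; left.
Qed.

Lemma ord_elem a b : ordinal a -> b ∈ a -> ordinal b.
Proof.
move=> [ta ea] hb; split; first exact: ea.
by move=> c hc; apply: ea; apply: ta hc.
Qed.

Lemma ord_trans a b c : ordinal c -> a ∈ b -> b ∈ c -> a ∈ c.
Proof. by move=> [tc _] h1 h2; apply: tc h1. Qed.

Lemma ord_asym a b : ordinal b -> a ∈ b -> ~ b ∈ a.
Proof. by move=> ob h1 h2; apply: (mem_irrefl b); apply: ord_trans h2 h1. Qed.

Lemma ord_suc a : ordinal a -> ordinal (suc a).
Proof.
move=> [ta ea]; split=> [b /in_suc [hb|->] c hc|b /in_suc [hb|->]] //.
- by apply/in_suc; left; apply: ta hc.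
- by apply/in_suc; left.
- exact: ea.
Qed.

(** Foundation is applied to the set of counterexamples up to [a], which exists because [P] is
    definable. *)
Lemma ord_ind (P : V -> Prop) : def1 P ->
  (forall a, ordinal a -> (forall b, b ∈ a -> P b) -> P a) ->
  forall a, ordinal a -> P a.
Proof.
move=> dP IH a oa; apply: NNPP => na.
have dN : def1 (fun x => ~ P x) by dtac.
have [|y [/(in_sep _ _ dN) [hy ny] hm]] :=
  ZF_foundation _ hZF (sep (suc a) (fun x => ~ P x)).
  by exists a; apply/in_sep => //; split=> //; apply: in_suc_self.
have osa := ord_suc _ oa.
apply: ny; apply: IH; first exact: ord_elem osa hy.
move=> b hb; apply: NNPP => nb; apply: (hm b) => //.
by apply/in_sep => //; split=> //; apply: ord_trans hb hy.
Qed.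

Lemma ord_least (P : V -> Prop) a : def1 P -> ordinal a -> P a ->
  exists b, ordinal b /\ P b /\ forall c, c ∈ b -> ~ P c.
Proof.
move=> dP oa ha; apply: NNPP => H.
have : forall a, ordinal a -> ~ P a; last by move=> /(_ a oa).
apply: ord_ind; first by dtac.
by move=> b ob IH hb; apply: H; exists b.
Qed.

(** Outer induction on [a], inner on [b]. An element of one that is missing from the other is
    comparable with it, hence lies at or above it; if there is none on either side, the two are
    equal by extensionality. *)
Lemma ord_total a b : ordinal a -> ordinal b -> a ∈ b \/ a = b \/ b ∈ a.
Proof.
move=> oa; move: a oa b.
apply: (ord_ind (fun a => forall b, ordinal b -> a ∈ b \/ a = b \/ b ∈ a)).
  by dtac.
move=> a oa IHa; apply: ord_ind; first by dtac.
move=> b ob IHb.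
have [[c [hc nc]]|Hab] := classic (exists c, c ∈ a /\ ~ c ∈ b).
  have [h|[<-|h]] := IHa c hc b ob; [by []|by right; right|].
  by right; right; apply: ord_trans oa h hc.
have [[c [hc nc]]|Hba] := classic (exists c, c ∈ b /\ ~ c ∈ a).
  have [h|[->|h]] := IHb c hc; [|by left|by []].
  by left; apply: ord_trans ob h hc.
right; left; apply: set_ext => z; split=> h; apply: NNPP => n.
  by apply: Hab; exists z.
by apply: Hba; exists z.
Qed.

Lemma ole_total a b : ordinal a -> ordinal b -> ole a b \/ b ∈ a.
Proof. by move=> oa ob; rewrite /ole; case: (ord_total _ _ oa ob); tauto. Qed.

Lemma ole_lt_trans a b c : ordinal c -> ole a b -> b ∈ c -> a ∈ c.
Proof. by move=> oc [h|->] // h'; apply: ord_trans h h'. Qed.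
Lemma lt_ole_trans a b c : ordinal c -> a ∈ b -> ole b c -> a ∈ c.
Proof. by move=> oc h [h'|<-] //; apply: ord_trans h h'. Qed.
Lemma ole_trans a b c : ordinal c -> ole a b -> ole b c -> ole a c.
Proof.
move=> oc h1 [h2|<-] //; left; exact: ole_lt_trans oc h1 h2.
Qed.
Lemma ole_antisym a b : ordinal a -> ordinal b -> ole a b -> ole b a -> a = b.
Proof. by move=> oa ob [h|->] // [h'|->] //; case: (ord_asym _ _ ob h). Qed.
Lemma ole_not_lt a b : ordinal b -> ole a b -> ~ b ∈ a.
Proof.
by move=> ob [h|->]; [apply: ord_asym|apply: mem_irrefl].
Qed.
Lemma lt_suc a b : a ∈ suc b <-> ole a b.
Proof. exact: in_suc. Qed.
Lemma suc_le a b : ordinal a -> ordinal b -> a ∈ b -> ole (suc a) b.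
Proof.
move=> oa ob h; case: (ole_total _ _ (ord_suc _ oa) ob) => // /lt_suc h'.
by case: (ole_not_lt _ _ oa h').
Qed.
Lemma suc_mono a b : ordinal b -> a ∈ b -> suc a ∈ suc b.
Proof.
by move=> ob h; apply/lt_suc; apply: suc_le => //; apply: ord_elem ob h.
Qed.
Lemma suc_inj a b : ordinal a -> ordinal b -> suc a = suc b -> a = b.
Proof.
move=> oa ob E; apply: ole_antisym => //; apply/lt_suc.
  by rewrite -E; apply: in_suc_self.
by rewrite E; apply: in_suc_self.
Qed.
Lemma suc_neq_emp a : suc a <> emp.
Proof. by move=> E; apply: (in_emp a); rewrite -E; apply: in_suc_self. Qed.
Lemma ord_emp : ordinal emp.
Proof. by split=> x /in_emp. Qed.
Lemma emp_le a : ordinal a -> ole emp a.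
Proof.
move=> oa; case: (ole_total _ _ ord_emp oa) => // /in_emp [].
Qed.
Lemma ord_max a b : ordinal a -> ordinal b ->
  exists c, (c = a \/ c = b) /\ ole a c /\ ole b c.
Proof.
move=> oa ob; case: (ole_total _ _ oa ob) => h; [exists b|exists a];
  by rewrite /ole in h *; tauto.
Qed.

Lemma is_sup_unique (P : V -> Prop) s s' : is_sup P s -> is_sup P s' -> s = s'.
Proof.
by move=> [o [u l]] [o' [u' l']]; apply: ole_antisym => //; [apply: l|apply: l'].
Qed.

Lemma is_sup_lt (P : V -> Prop) s x : is_sup P s -> (forall a, P a -> ordinal a) -> x ∈ s ->
  exists a, P a /\ x ∈ a.
Proof.
move=> [o [u l]] hP hx; apply: NNPP => H; have ox := ord_elem _ _ o hx.
have : ole s x; last by move=> h; apply: (ole_not_lt _ _ ox h).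
apply: l => // a ha; case: (ole_total _ _ (hP _ ha) ox) => // h.
by case: H; exists a.
Qed.

(** * Natural numbers *)

Implicit Types (n m : V).

Lemma naturalE n : natural n <-> ordinal n /\
  forall m, ole m n -> m = emp \/ exists k, m = suc k.
Proof.
split=> - [on h]; split=> // m /h; rewrite is_emptyE => - [|[k]]; try tauto.
  by move/is_succE=> ->; right; exists k.
by move=> ->; right; exists k; apply/is_succE.
Qed.
Lemma nat_ord n : natural n -> ordinal n.
Proof. by case. Qed.
Lemma nat_emp : natural emp.
Proof.
apply/naturalE; split; first exact: ord_emp.
by move=> m [/in_emp|->]; last left.
Qed.
Lemma nat_suc n : natural n -> natural (suc n).
Proof.
move=> /naturalE [on h]; apply/naturalE; split; first exact: ord_suc.
by move=> m [/lt_suc /h|->] //; right; exists n.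
Qed.
Lemma nat_elem n m : natural n -> m ∈ n -> natural m.
Proof.
move=> [on h] hm; split; first exact: ord_elem on hm.
by move=> k hk; apply: h; left; apply: ole_lt_trans on hk hm.
Qed.
Lemma nat_case n : natural n -> n = emp \/ exists k, natural k /\ n = suc k.
Proof.
move=> hn; have [_ /(_ n) H] := proj1 (naturalE n) hn.
case: H => [|->|[k E]]; [by right|by left|right; exists k; split=> //].
by apply: nat_elem hn _; rewrite E; apply: in_suc_self.
Qed.
Lemma nat_ind (P : V -> Prop) : def1 P -> P emp ->
  (forall n, natural n -> P n -> P (suc n)) -> forall n, natural n -> P n.
Proof.
move=> dP P0 PS n hn; move: (nat_ord _ hn) (hn); move: n {hn}.
apply: (ord_ind (fun n => natural n -> P n)); first by dtac.
move=> n on IH hn; case: (nat_case _ hn) => [->|[k [hk E]]] //; subst n.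
by apply: PS => //; apply: IH => //; apply: in_suc_self.
Qed.

Lemma ex_omega : { w : V | is_omega w }.
Proof.
apply: constructive_indefinite_description.
have [I [[o [/is_emptyE -> h0]] hS]] := ZF_infinity _ hZF.
have H : forall n, natural n -> n ∈ I.
  apply: nat_ind => //; first by dtac.
  by move=> n _ /hS [s [/is_succE ->]].
exists (sep I natural) => n; rewrite in_sep; first by dtac.
by split=> [[]|hn] //; split=> //; apply: H.
Qed.
Definition om : V := proj1_sig ex_omega.
Lemma in_om n : n ∈ om <-> natural n.
Proof. exact: (proj2_sig ex_omega). Qed.
Lemma is_omegaE w : is_omega w <-> w = om.
Proof.
split=> [h|-> n]; last exact: in_om.
by apply: set_ext => z; rewrite h in_om.
Qed.
Lemma ord_om : ordinal om.
Proof.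
split=> [n /in_om hn m hm|n /in_om /nat_ord []] //.
by apply/in_om; apply: nat_elem hn hm.
Qed.
Lemma om_suc n : n ∈ om -> suc n ∈ om.
Proof. by move/in_om=> h; apply/in_om; apply: nat_suc. Qed.
Lemma om_emp : emp ∈ om.
Proof. by apply/in_om; apply: nat_emp. Qed.
Lemma om_limit : limit om.
Proof.
split; first exact: ord_om; split; first by move/(_ emp); apply; apply: om_emp.
move=> [b /is_succE E]; apply: (mem_irrefl om); rewrite {1}E.
by apply: om_suc; rewrite E; apply: in_suc_self.
Qed.
Lemma om_ind (P : V -> Prop) : def1 P -> P emp ->
  (forall n, n ∈ om -> P n -> P (suc n)) -> forall n, n ∈ om -> P n.
Proof.
move=> dP P0 PS n /in_om; apply: nat_ind => // m hm.
by apply: PS; apply/in_om.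
Qed.
Lemma om_trans n m : n ∈ om -> m ∈ n -> m ∈ om.
Proof. by move=> hn hm; apply: ord_trans ord_om hm hn. Qed.
Lemma om_ord n : n ∈ om -> ordinal n.
Proof. by move/in_om/nat_ord. Qed.

#[local] Hint Resolve def_restr : defs.

(** * Transfinite recursion *)

Implicit Types (s K : V).

(** The union of approximations is replaced by a single induction: the approximation on [b] takes at
    [c] the value that [G] gives to the unique approximation on [c]. The set [K] of possible values
    is given in advance, so Separation suffices to form it. *)
Lemma recursion (G : V -> V -> V -> Prop) K a : def3 G -> ordinal a ->
  (forall b h, b ∈ a -> function h b K -> exists v, v ∈ K /\ G b h v) ->
  (forall b h v v', G b h v -> G b h v' -> v = v') ->
  exists s, function s a K /\ forall b, b ∈ a -> G b (restr s b) (ap s b).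
Proof.
move=> dG oa Gex Gun.
pose (Ap := fun b h => function h b K /\
  forall c, c ∈ b -> G c (restr h c) (ap h c)).
have dAp : def2 Ap by rewrite /Ap; dtac.
have restr_eq b h b' h' c : ordinal b -> ordinal b' -> Ap b h -> Ap b' h' ->
    c ∈ b -> c ∈ b' -> (forall d, d ∈ c -> ap h d = ap h' d) ->
    restr h c = restr h' c.
  move=> ob ob' [fh _] [fh' _] hc hc' E.
  have s : subset c b by move=> z hz; apply: ord_trans hz hc.
  have s' : subset c b' by move=> z hz; apply: ord_trans hz hc'.
  apply: (fun_ext _ _ c); try exact: (proj1 (restr_function _ _ _ _ fh s)).
    exact: (proj1 (restr_function _ _ _ _ fh' s')).
  move=> d hd; rewrite (ap_restr _ _ _ _ _ fh s hd).
  by rewrite (ap_restr _ _ _ _ _ fh' s' hd); apply: E.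
have Ap_un b h b' h' : ordinal b -> ordinal b' -> Ap b h -> Ap b' h' ->
    forall c, ordinal c -> c ∈ b -> c ∈ b' -> ap h c = ap h' c.
  move=> ob ob' A A'; apply: ord_ind; first by dtac.
  move=> c oc IH hc hc'.
  apply: (Gun c (restr h c)); first exact: (proj2 A).
  have -> : restr h c = restr h' c; last exact: (proj2 A').
  apply: (restr_eq b h b' h') => // d hd.
  by apply: IH => //; [apply: ord_trans ob hd hc|apply: ord_trans ob' hd hc'].
have Ap_restr b h c : ordinal b -> Ap b h -> c ∈ b -> Ap c (restr h c).
  move=> ob [fh Gh] hc.
  have s : subset c b by move=> z hz; apply: ord_trans hz hc.
  have oc := ord_elem _ _ ob hc.
  split; first exact: restr_function fh s.
  move=> d hd; rewrite (ap_restr _ _ _ _ _ fh s hd).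
  have -> : restr (restr h c) d = restr h d; last by apply: Gh; apply: s.
  apply: set_ext => p; rewrite !in_restr.
  split=> [[[]]|[hp [u [v [hu E]]]]] //; split; last by exists u, v.
  by split=> //; exists u, v; split=> //; apply: ord_trans hu hd.
have Ap_ex : forall b, ordinal b -> ole b a -> exists h, Ap b h.
  apply: ord_ind; first by dtac.
  move=> b ob IH hb.
  have sub c : c ∈ b -> c ∈ a by move=> hc; apply: lt_ole_trans oa hc hb.
  pose (H := fun c v => exists h, Ap c h /\ G c h v).
  have dH : def2 H by rewrite /H; dtac.
  have Hex c : c ∈ b -> exists v, v ∈ K /\ H c v.
    move=> hc; have [|h A] := IH c hc; first by left; apply: sub.
    have [v [hv Gv]] := Gex _ _ (sub _ hc) (proj1 A).
    by exists v; split=> //; exists h.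
  have Hun c v v' : c ∈ b -> H c v -> H c v' -> v = v'.
    move=> hc [h [A g]] [h' [A' g']].
    have oc := ord_elem _ _ ob hc.
    have E : h = h'.
      apply: (fun_ext _ _ c); [by case: A => [[]]|by case: A' => [[]]|].
      move=> d hd; apply: (Ap_un c h c h') => //; exact: ord_elem oc hd.
    by apply: (Gun c h) => //; rewrite E.
  have fg := graph_function b K H dH Hex Hun.
  exists (graph b K H); split=> // c hc.
  have [h [A g]] := graph_ap b K H c dH Hex Hun hc.
  have oc := ord_elem _ _ ob hc.
  have sc : subset c b by move=> z hz; apply: ord_trans hz hc.
  suff -> : restr (graph b K H) c = h by [].
  apply: (fun_ext _ _ c); [|by case: A => [[]]|].
    exact: (proj1 (restr_function _ _ _ _ fg sc)).
  move=> d hd; rewrite (ap_restr _ _ _ _ _ fg sc hd).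
  apply: (Hun d); [exact: sc|apply: graph_ap => //; exact: sc|].
  exists (restr h d); split; first exact: Ap_restr A hd.
  by case: A => _; apply.
by have [|s [fs Gs]] := Ap_ex a oa; [right|exists s].
Qed.

(** The next term is the least admissible ordinal, which makes the recursion relation functional
    without choice. By [reg] the earlier terms have a common bound in [K], and [ex] supplies a term
    that is good for everything below that bound. *)
Lemma sequence (D : V -> Prop) (Good : V -> V -> Prop) K a :
  def1 D -> def2 Good -> ordinal K -> ordinal a ->
  (forall b f, b ∈ a -> function f b K ->
     exists c, c ∈ K /\ forall x, x ∈ b -> ap f x ∈ c) ->
  (forall b, b ∈ K -> exists c, c ∈ K /\ D c /\ forall d, d ∈ b -> Good d c) ->
  exists s, function s a K /\
    forall b, b ∈ a -> D (ap s b) /\ forall m, m ∈ b -> Good (ap s m) (ap s b).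
Proof.
move=> dD dGood oK oa reg ex.
pose (Q := fun b h v => v ∈ K /\ D v /\ forall m, m ∈ b -> Good (ap h m) v).
have dQ : def3 Q by rewrite /Q; dtac.
have [||||s [fs H]] := recursion
  (fun b h v => Q b h v /\ forall c, c ∈ v -> ~ Q b h c) K a.
- by dtac.
- by [].
- move=> b h hb fh.
  have [c [hc bd]] := reg b h hb fh; have [v [hv [Dv gv]]] := ex c hc.
  have [|||u [ou [Qu m]]] := ord_least (Q b h) v.
  + by dtac.
  + exact: ord_elem oK hv.
  + by split=> //; split=> // m hm; apply: gv; apply: bd.
  + by exists u; split=> //; case: Qu.
- move=> b h v v' [q m] [q' m'].
  have ov := ord_elem _ _ oK (proj1 q); have ov' := ord_elem _ _ oK (proj1 q').
  by case: (ord_total _ _ ov ov') => [/m'|[->|/m]].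
- exists s; split=> // b hb; have [[_ [Db Gb]] _] := H b hb; split=> // m hm.
  have sb : subset b a by move=> z hz; apply: ord_trans hz hb.
  by have := Gb m hm; rewrite (ap_restr _ _ _ _ _ fs sb hm).
Qed.

(** * Arithmetic *)

Implicit Types (d k : V).

Lemma is_sup_ext (P Q : V -> Prop) s : (forall a, P a <-> Q a) ->
  is_sup P s -> is_sup Q s.
Proof.
move=> E [os [ub lub]]; split=> //; split=> [a /E /ub|u ou h] //.
by apply: lub => // a /E /h.
Qed.

Lemma add_emp a : is_add a emp a.
Proof.
have dF : fdef1 (fun _ : V => a) by dtac.
have hF (t : V) : t ∈ suc emp -> a ∈ suc a by move=> _; apply: in_suc_self.
have [fh _] := lam_function _ _ _ dF hF.
have hm t y : maps (lam (suc emp) (suc a) (fun _ => a)) t y -> t = emp /\ y = a.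
  move/(maps_apE _ _ _ _ fh) => [ht ->]; rewrite ap_lam //; split=> //.
  by move/in_suc: ht => [/in_emp|].
exists (suc emp), (lam (suc emp) (suc a) (fun _ => a)); split.
  exact/is_succE.
split=> //; split.
  apply/(maps_apE _ _ _ _ fh); split; first exact: in_suc_self.
  by rewrite ap_lam //; apply: in_suc_self.
move=> t y /hm [-> ->]; split=> //; split.
  by move=> s u /is_succE E; case: (suc_neq_emp s).
by move=> [_ [n _]]; case: n; apply/is_emptyE.
Qed.

(** The recursion history for [b] is extended by the pair of [suc b] and [suc c]. The clauses at
    older arguments refer only to smaller ones and do not meet the new pair. *)
Lemma add_suc a b c : ordinal b -> is_add a b c -> is_add a (suc b) (suc c).
Proof.
move=> ob [d [h [/is_succE -> [fh [hbc H]]]]].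
pose (p0 := opair (suc b) (suc c)).
pose (h' := cup h (upair p0 p0)).
have osb := ord_suc _ ob.
have hE t y : maps h' t y <-> maps h t y \/ (t = suc b /\ y = suc c).
  rewrite !mapsE in_cup in_upair; split=> [[h1|h1]|[h1|[-> ->]]].
  - by left.
  - by right; case: h1 => /opair_inj.
  - by left.
  - by right; left.
have dm t y : maps h t y -> t ∈ suc b by apply: maps_dom fh.
have nsb y : ~ maps h (suc b) y by move=> /dm; apply: mem_irrefl.
exists (suc (suc b)), h'; split; first exact/is_succE.
split.
  split.
    move=> p /in_cup [hp|/in_upair hp].
      have [t [y [ht hty]]] := proj1 fh _ hp.
      by exists t, y; split=> //; apply/in_suc; left.
    exists (suc b), (suc c); split; first exact: in_suc_self.
    by apply/is_opairE; case: hp.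
  move=> t /in_suc [ht|->].
    have [y [hy un]] := proj2 fh _ ht; exists y; split; first by apply/hE; left.
    move=> y' /hE [/un|[E _]] //; case: (mem_irrefl (suc b)); by rewrite -{1}E.
  exists (suc c); split; first by apply/hE; right.
  by move=> y /hE [/nsb|[_ ->]].
split; first by apply/hE; right.
move=> t y /hE [hty|[-> ->]]; last first.
  split; first by move/is_emptyE=> E; case: (suc_neq_emp b).
  split; last by move=> [_ [_ n]]; case: n; exists b; apply/is_succE.
  move=> s u /is_succE E.
  have os : ordinal s by apply: (ord_elem _ _ osb); rewrite E; apply: in_suc_self.
  move: E => /suc_inj -/(_ ob os) <- /hE [hu|[E _]].
    by apply/is_succE; rewrite (maps_val _ _ _ _ fh hu) (maps_val _ _ _ _ fh hbc).
  by case: (mem_irrefl b); rewrite {2}E; apply: in_suc_self.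
have tb := dm _ _ hty.
have [H1 [H2 H3]] := H _ _ hty; split=> //; split.
  move=> s u /is_succE E /hE [hu|[Es _]]; first by apply: H2 hu; apply/is_succE.
  case: (ord_asym _ _ osb tb); rewrite E Es; exact: in_suc_self.
move=> lt; apply: is_sup_ext (H3 lt) => u.
split=> - [s [st hs]]; exists s; split=> //; first by apply/hE; left.
move/hE: hs => [|[E _]] //; case: (ord_asym _ _ osb tb); by rewrite -E.
Qed.

Lemma add_emp_inv a c : is_add a emp c -> c = a.
Proof.
move=> [d [h [_ [_ [h1 /(_ _ _ h1) [H _]]]]]].
by apply: H; apply/is_emptyE.
Qed.

Lemma add_suc_inv a b c : ordinal b -> is_add a (suc b) c ->
  exists c', is_add a b c' /\ c = suc c'.
Proof.
move=> ob [d [h [/is_succE -> [fh [hc H]]]]].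
have hb : b ∈ suc (suc b) by apply/in_suc; left; apply: in_suc_self.
have hb' := maps_ap _ _ _ fh hb.
exists (ap h b); split; last first.
  have [_ [/(_ b (ap h b)) H2 _]] := H _ _ hc.
  by apply/is_succE; apply: H2 => //; apply/is_succE.
(* A crude codomain, needed only so that the lemmas on restriction apply to [h]. *)
have F : function h (suc (suc b)) (union (union h)).
  split=> // t y /mapsE h1; apply/in_union; exists (upair t y); split.
    by apply/in_union; exists (opair t y); split=> //; apply/in_upair; right.
  by apply/in_upair; right.
have s : subset (suc b) (suc (suc b)) by move=> z hz; apply/in_suc; left.
exists (suc b), (restr h (suc b)); split; first exact/is_succE.
split; first by case: (restr_function _ _ _ _ F s).
split; first by apply/maps_restr; split=> //; apply: in_suc_self.
move=> t y /maps_restr [ht hty]; have [H1 [H2 H3]] := H _ _ hty.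
split=> //; split.
  by move=> r u E /maps_restr [_ hu]; apply: H2 hu.
move=> lt; apply: is_sup_ext (H3 lt) => u.
split=> - [r [rt hr]]; exists r; split=> //; last by case/maps_restr: hr.
by apply/maps_restr; split=> //; apply: ord_trans (ord_suc _ ob) rt ht.
Qed.

Lemma add_nat_ex b : natural b -> forall a, natural a ->
  exists c, natural c /\ is_add a b c.
Proof.
move: b; apply: nat_ind; first by dtac.
  by move=> a ha; exists a; split=> //; apply: add_emp.
move=> b hb IH a ha; have [c [hc h]] := IH a ha; exists (suc c).
by split; [apply: nat_suc|apply: add_suc => //; apply: nat_ord].
Qed.

Lemma add_nat_unique b : natural b -> forall a c c',
  is_add a b c -> is_add a b c' -> c = c'.
Proof.
move: b; apply: nat_ind; first by dtac.
  by move=> a c c' /add_emp_inv -> /add_emp_inv ->.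
move=> b /nat_ord ob IH a c c' /(add_suc_inv _ _ _ ob) [d [hd ->]].
by move/(add_suc_inv _ _ _ ob) => [d' [hd' ->]]; rewrite (IH _ _ _ hd hd').
Qed.

(** Doubling a successor increases both summands, whereas the recursion is on the right one; this
    moves the successor out of the left one. *)
Lemma add_suc_l b : natural b -> forall a c,
  is_add a b c -> is_add (suc a) b (suc c).
Proof.
move: b; apply: nat_ind; first by dtac.
  by move=> a c /add_emp_inv ->; apply: add_emp.
move=> b /nat_ord ob IH a c /(add_suc_inv _ _ _ ob) [d [hd ->]].
by apply: add_suc => //; apply: IH.
Qed.

(** As a set, doubling is itself a real, so it can serve as a list of positions in other reals. *)
Definition dbl : V := graph om om (fun n d => is_add n n d).

Lemma dbl_spec : function dbl om om /\ forall n, n ∈ om -> is_add n n (ap dbl n).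
Proof.
have d : def2 (fun n d : V => is_add n n d) by dtac.
have ex n : n ∈ om -> exists d, d ∈ om /\ is_add n n d.
  move/in_om=> hn; have [c [hc h]] := add_nat_ex n hn n hn.
  by exists c; rewrite in_om.
have un n c c' : n ∈ om -> is_add n n c -> is_add n n c' -> c = c'.
  by move/in_om=> hn; apply: add_nat_unique.
split; first exact: graph_function.
by move=> n; apply: (graph_ap om om (fun n d => is_add n n d)).
Qed.

Lemma dbl_fun : function dbl om om.
Proof. by case: dbl_spec. Qed.

Lemma dbl_om n : n ∈ om -> ap dbl n ∈ om.
Proof. exact: ap_in dbl_fun. Qed.

Lemma doubleE n d : n ∈ om -> double n d <-> d = ap dbl n.
Proof.
move=> hn; have [_ h] := dbl_spec; split=> [h'|->]; last exact: h.
by apply: (add_nat_unique n); [apply/in_om|exact: h'|exact: h].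
Qed.

Lemma dbl_emp : ap dbl emp = emp.
Proof. by symmetry; apply/doubleE; [exact: om_emp|exact: add_emp]. Qed.

Lemma dbl_suc n : n ∈ om -> ap dbl (suc n) = suc (suc (ap dbl n)).
Proof.
move=> hn; symmetry; apply/doubleE; first exact: om_suc.
apply: add_suc; first exact: om_ord.
apply: add_suc_l; first exact/in_om.
by case: dbl_spec => _; apply.
Qed.

Lemma dbl_mono m : m ∈ om -> forall n, n ∈ m -> ap dbl n ∈ ap dbl m.
Proof.
move: m; apply: om_ind; first by dtac.
  by move=> n /in_emp.
move=> m hm IH n /in_suc hn; rewrite dbl_suc //.
have ho := ord_suc _ (ord_suc _ (om_ord _ (dbl_om _ hm))).
case: hn => [/IH h|->]; last by apply/in_suc; left; apply: in_suc_self.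
by apply: ord_trans ho h _; apply/in_suc; left; apply: in_suc_self.
Qed.

Lemma dbl_inj n m : n ∈ om -> m ∈ om -> ap dbl n = ap dbl m -> n = m.
Proof.
move=> hn hm E; case: (ord_total n m (om_ord _ hn) (om_ord _ hm)).
  by move/(dbl_mono _ hm); rewrite E => /mem_irrefl.
by case=> // /(dbl_mono _ hn); rewrite E => /mem_irrefl.
Qed.

Lemma evenE n : even n <-> exists m, m ∈ om /\ n = ap dbl m.
Proof.
split=> [[m [/in_om hm h]]|[m [hm h]]]; exists m; first by split=> //; apply/doubleE.
by split; [apply/in_om|apply/doubleE].
Qed.

Lemma oddE n : odd n <-> exists m, m ∈ om /\ n = suc (ap dbl m).
Proof.
split=> [[k [/evenE [m [hm ->]] /is_succE ->]]|[m [hm ->]]]; first by exists m.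
by exists (ap dbl m); split; [apply/evenE; exists m|apply/is_succE].
Qed.

Lemma even_om n : even n -> n ∈ om.
Proof. by move/evenE=> [m [hm ->]]; apply: dbl_om. Qed.
Lemma odd_om n : odd n -> n ∈ om.
Proof. by move/oddE=> [m [hm ->]]; apply: om_suc; apply: dbl_om. Qed.

Lemma dbl_neq_suc n : n ∈ om -> forall m, m ∈ om -> ap dbl n <> suc (ap dbl m).
Proof.
move: n; apply: om_ind; first by dtac.
  by move=> m hm; rewrite dbl_emp => E; case: (suc_neq_emp (ap dbl m)).
move=> n hn IH m hm; rewrite dbl_suc // => E.
have on := om_ord _ (dbl_om _ hn).
have om' := om_ord _ (dbl_om _ hm).
move: E => /(suc_inj _ _ (ord_suc _ on) om') E.
case: (nat_case m (proj1 (in_om m) hm)) => [Em|[k [/in_om hk Em]]].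
  by move: E; rewrite Em dbl_emp => /suc_neq_emp.
move: E; rewrite Em dbl_suc // => E; apply: (IH k hk).
exact: suc_inj on (ord_suc _ (om_ord _ (dbl_om _ hk))) E.
Qed.

Lemma even_not_odd n : even n -> ~ odd n.
Proof.
by move=> /evenE [m [hm ->]] /oddE [k [hk]]; apply: dbl_neq_suc.
Qed.

(** Finitely many values of a real are bounded; this provides the modulus of continuity of a
    reindexing. *)
Lemma om_bound f n : n ∈ om -> function f om om ->
  exists m, m ∈ om /\ forall k, k ∈ n -> ap f k ∈ m.
Proof.
move=> hn hf; move: n hn; apply: om_ind; first by dtac.
  by exists emp; split; [apply: om_emp|move=> k /in_emp].
move=> n hn [m [hm IH]].
have hs := om_suc _ (ap_in _ _ _ _ hf hn).
have [c [hc [h1 h2]]] := ord_max m (suc (ap f n)) (om_ord _ hm) (om_ord _ hs).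
have hco : c ∈ om by case: hc => ->.
exists c; split=> // k /in_suc [/IH hk|->].
  exact: lt_ole_trans (om_ord _ hco) hk h1.
exact: lt_ole_trans (om_ord _ hco) (in_suc_self _) h2.
Qed.

(** * Reals, reindexing and strategies *)

Implicit Types (r w j : V).

Lemma realE x : real x <-> function x om om.
Proof.
by split=> [[w [/is_omegaE ->]]|h] //; exists om; rewrite is_omegaE.
Qed.

Definition RR : V := sep (power (prod om om)) real.

Lemma function_subset f A B : function f A B -> subset f (prod A B).
Proof.
move=> hf p hp; have [a [ha ->]] := function_opair _ _ _ (proj1 hf) hp.
by apply/in_prod; exists a, (ap f a); split=> //; split=> //; apply: ap_in hf ha.
Qed.

Lemma in_RR x : x ∈ RR <-> real x.
Proof.
rewrite in_sep; first by dtac.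
split=> [[]|h] //; split=> //; apply/in_power.
by apply: function_subset; apply/realE.
Qed.

Lemma is_realsE R0 : is_reals R0 <-> R0 = RR.
Proof.
split=> [h|-> x]; last exact: in_RR.
by apply: set_ext => z; rewrite h in_RR.
Qed.

Lemma real_ap x n : real x -> n ∈ om -> ap x n ∈ om.
Proof. by move/realE; apply: ap_in. Qed.

Lemma real_ext x y : real x -> real y -> (forall n, n ∈ om -> ap x n = ap y n) ->
  x = y.
Proof. by move=> /realE [hx _] /realE [hy _]; apply: fun_ext. Qed.

Lemma real_maps x n v : real x -> maps x n v <-> n ∈ om /\ v = ap x n.
Proof. by move=> /realE [hx _]; apply: maps_apE. Qed.

Lemma real_lam (F : V -> V) : fdef1 F -> (forall n, n ∈ om -> F n ∈ om) ->
  real (lam om om F).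
Proof. by move=> dF h; apply/realE; apply: lam_function. Qed.

Lemma agreeE x y n : real x -> real y -> subset n om ->
  agree n x y <-> forall k, k ∈ n -> ap x k = ap y k.
Proof.
move=> hx hy s; split=> [h k hk|h k u hk].
  have /(h k _ hk) : maps x k (ap x k) by apply/real_maps => //; split=> //; apply: s.
  by move/(real_maps _ _ _ hy) => [].
by rewrite !real_maps // (h k hk).
Qed.

Lemma om_subset n : n ∈ om -> subset n om.
Proof. by move=> hn k hk; apply: om_trans hn hk. Qed.

(** Reading [r] at the positions listed by [j]. For fixed [j] this is continuous in [r], and it is
    the one device by which the parts of a run and the two halves of a join are extracted. *)
Definition cmp r j : V := lam om om (fun n => ap r (ap j n)).

Lemma def_cmp : fdef2 cmp.
Proof.
apply: (fdef2_by _ (fun y r j => forall p, p ∈ y <-> p ∈ prod om om /\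
  exists a b, p = opair a b /\ b = ap r (ap j a))); last by dtac.
move=> y r j.
have H p : p ∈ cmp r j <-> p ∈ prod om om /\
  exists a b, p = opair a b /\ b = ap r (ap j a) by apply: in_sep; dtac.
split=> [->|h] //; by apply: set_ext => p; rewrite h H.
Qed.
#[local] Hint Resolve def_cmp : defs.

Lemma real_cmp r j : real r -> real j -> real (cmp r j).
Proof.
move=> hr hj; apply: real_lam; first by dtac.
by move=> n hn; apply: real_ap => //; apply: real_ap.
Qed.

Lemma ap_cmp r j n : real r -> real j -> n ∈ om -> ap (cmp r j) n = ap r (ap j n).
Proof.
move=> hr hj hn; rewrite ap_lam //; first by dtac.
by move=> m hm; apply: real_ap => //; apply: real_ap.
Qed.

Lemma real_dbl : real dbl.
Proof. exact/realE/dbl_fun. Qed.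

Definition nxt j : V := lam om om (fun n => suc (ap j n)).
Lemma real_nxt j : real j -> real (nxt j).
Proof.
move=> hj; apply: real_lam; first by dtac.
by move=> n hn; apply: om_suc; apply: real_ap.
Qed.
Lemma ap_nxt j n : real j -> n ∈ om -> ap (nxt j) n = suc (ap j n).
Proof.
move=> hj hn; rewrite ap_lam //; first by dtac.
by move=> m hm; apply: om_suc; apply: real_ap.
Qed.

Definition zero : V := lam om om (fun _ => emp).
Lemma real_zero : real zero.
Proof. by apply: real_lam; [dtac|move=> n _; apply: om_emp]. Qed.

(** The converse of reading two parts of a real at disjoint positions. The default [emp] at all
    other positions fixes the ignored moves of a run. *)
Lemma merge a b x y : real a -> real b -> real x -> real y ->
  (forall n m, n ∈ om -> m ∈ om -> ap a n = ap a m -> n = m) ->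
  (forall n m, n ∈ om -> m ∈ om -> ap b n = ap b m -> n = m) ->
  (forall n m, n ∈ om -> m ∈ om -> ap a n <> ap b m) ->
  exists w, real w /\ cmp w a = x /\ cmp w b = y /\
    forall m, m ∈ om -> (forall n, n ∈ om -> m <> ap a n /\ m <> ap b n) ->
      ap w m = emp.
Proof.
move=> ha hb hx hy ia ib dab.
pose (P := fun m v =>
  (exists n, n ∈ om /\ m = ap a n /\ v = ap x n) \/
  (exists n, n ∈ om /\ m = ap b n /\ v = ap y n) \/
  ((forall n, n ∈ om -> m <> ap a n /\ m <> ap b n) /\ v = emp)).
have dP : def2 P by rewrite /P; dtac.
have ex m : m ∈ om -> exists v, v ∈ om /\ P m v.
  move=> hm.
  have [[n [hn E]]|na] := classic (exists n, n ∈ om /\ m = ap a n).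
    by exists (ap x n); split; [apply: real_ap|left; exists n].
  have [[n [hn E]]|nb] := classic (exists n, n ∈ om /\ m = ap b n).
    by exists (ap y n); split; [apply: real_ap|right; left; exists n].
  exists emp; split; first exact: om_emp.
  right; right; split=> // n hn.
  by split=> E; [apply: na|apply: nb]; exists n.
have un m v v' : m ∈ om -> P m v -> P m v' -> v = v'.
  move=> hm [[n [hn [E ->]]]|[[n [hn [E ->]]]|[N ->]]]
    [[n' [hn' [E' ->]]]|[[n' [hn' [E' ->]]]|[N' ->]]] //.
  - by rewrite (ia n n') // -E.
  - by case: (dab n n') => //; rewrite -E.
  - by case: (N' n hn).
  - by case: (dab n' n) => //; rewrite -E'.
  - by rewrite (ib n n') // -E.
  - by case: (N' n hn).
  - by case: (N n' hn').
  - by case: (N n' hn').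
have hw : real (graph om om P) by apply/realE; apply: graph_function.
have hP m : m ∈ om -> P m (ap (graph om om P) m) by apply: graph_ap.
exists (graph om om P); split=> //; split; last split.
- apply: real_ext => //; first exact: real_cmp.
  move=> n hn; rewrite ap_cmp //; have hn' := real_ap _ _ ha hn.
  apply: (un _ _ _ hn' (hP _ hn')); by left; exists n.
- apply: real_ext => //; first exact: real_cmp.
  move=> n hn; rewrite ap_cmp //; have hn' := real_ap _ _ hb hn.
  apply: (un _ _ _ hn' (hP _ hn')); by right; left; exists n.
move=> m hm h; apply: (un _ _ _ hm (hP _ hm)); by right; right.
Qed.

(* The run of a game consists of x (read off at the indices 4n), y (4n+1) and
   z (4n+3); the moves 4n+2 are ignored, so that z(n) depends on x(0),...,x(n)
   only. *)
Definition ix : V := cmp dbl dbl.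
Definition iy : V := nxt ix.
Definition iz : V := nxt (nxt iy).

Lemma real_ix : real ix.
Proof. by apply: real_cmp; apply: real_dbl. Qed.
Lemma real_iy : real iy.
Proof. exact/real_nxt/real_ix. Qed.
Lemma real_iz : real iz.
Proof. exact/real_nxt/real_nxt/real_iy. Qed.

Lemma ap_ix n : n ∈ om -> ap ix n = ap dbl (ap dbl n).
Proof. by move=> hn; rewrite ap_cmp //; apply: real_dbl. Qed.
Lemma ap_iy n : n ∈ om -> ap iy n = suc (ap ix n).
Proof. by move=> hn; rewrite ap_nxt //; apply: real_ix. Qed.
Lemma ap_iz n : n ∈ om -> ap iz n = suc (ap dbl (suc (ap dbl n))).
Proof.
move=> hn; rewrite ap_nxt //; first exact/real_nxt/real_iy.
rewrite ap_nxt //; first exact: real_iy.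
by rewrite ap_iy // ap_ix // dbl_suc //; apply: dbl_om.
Qed.

Lemma even_ix n : n ∈ om -> even (ap ix n).
Proof.
move=> hn; rewrite ap_ix //; apply/evenE; exists (ap dbl n); split=> //.
exact: dbl_om.
Qed.
Lemma odd_iy n : n ∈ om -> odd (ap iy n).
Proof.
move=> hn; rewrite ap_iy // ap_ix //; apply/oddE; exists (ap dbl n); split=> //.
exact: dbl_om.
Qed.
Lemma odd_iz n : n ∈ om -> odd (ap iz n).
Proof.
move=> hn; rewrite ap_iz //; apply/oddE; exists (suc (ap dbl n)); split=> //.
exact/om_suc/dbl_om.
Qed.

Lemma ix_inj n m : n ∈ om -> m ∈ om -> ap ix n = ap ix m -> n = m.
Proof.
move=> hn hm; rewrite !ap_ix // => h; apply: dbl_inj => //.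
by apply: dbl_inj h; apply: dbl_om.
Qed.
Lemma iy_inj n m : n ∈ om -> m ∈ om -> ap iy n = ap iy m -> n = m.
Proof.
move=> hn hm; rewrite !ap_iy // => /suc_inj h; apply: ix_inj => //.
by apply: h; apply: om_ord; apply: real_ap => //; apply: real_ix.
Qed.
Lemma iz_inj n m : n ∈ om -> m ∈ om -> ap iz n = ap iz m -> n = m.
Proof.
move=> hn hm; rewrite !ap_iz // => /suc_inj h; apply: dbl_inj => //.
have hn' := dbl_om _ hn; have hm' := dbl_om _ hm.
apply: suc_inj; try exact: om_ord.
apply: dbl_inj; try exact: om_suc.
by apply: h; apply: om_ord; apply: dbl_om; apply: om_suc.
Qed.
Lemma iy_neq_iz n m : n ∈ om -> m ∈ om -> ap iy n <> ap iz m.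
Proof.
move=> hn hm; rewrite ap_iy // ap_iz // ap_ix //.
have hn' := dbl_om _ hn; have hm' := dbl_om _ hm.
move/suc_inj => h; apply: (dbl_neq_suc _ hn _ hm).
apply: dbl_inj => //; first exact: om_suc.
by apply: h; apply: om_ord; apply: dbl_om => //; apply: om_suc.
Qed.
Lemma ix_neq_iz n m : n ∈ om -> m ∈ om -> ap ix n <> ap iz m.
Proof.
move=> hn hm E; apply: (even_not_odd (ap ix n)); first exact: even_ix.
by rewrite E; apply: odd_iz.
Qed.

(** If [k > n], then [4k >= 4n + 4], which is beyond [4n + 3]. This is the index computation behind
    the Lipschitz constant 1. *)
Lemma ix_lt_iz n k : n ∈ om -> k ∈ om -> ap ix k ∈ ap iz n -> ole k n.
Proof.
move=> hn hk h; case: (ole_total _ _ (om_ord _ hk) (om_ord _ hn)) => // lt.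
have hsn := om_suc _ hn.
have le : ole (ap ix (suc n)) (ap ix k).
  case: (suc_le _ _ (om_ord _ hn) (om_ord _ hk) lt) => [l|->]; last by right.
  by left; rewrite !ap_ix //; apply: dbl_mono; apply: dbl_mono || apply: dbl_om.
have E : ap ix (suc n) = suc (ap iz n).
  by rewrite ap_ix // dbl_suc // dbl_suc ?ap_iz //; apply/om_suc/dbl_om.
have hz := real_ap _ _ real_iz hn.
have hx := real_ap _ _ real_ix hk.
case: (mem_irrefl (ap iz n)); apply: (ord_trans _ (ap ix k)) => //.
  exact: om_ord.
apply: (lt_ole_trans _ (suc (ap iz n))); first exact: om_ord.
  exact: in_suc_self.
by rewrite -E.
Qed.

(** * Strategies, runs and Lipschitz functions *)

Lemma strategy_ap sigma s n : strategy sigma -> n ∈ om -> function s n om ->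
  ap sigma s ∈ om /\ maps sigma s (ap sigma s).
Proof.
move=> [S [w [hS [/is_omegaE -> hf]]]] hn hs.
have h : s ∈ S by apply/hS; exists om, n; rewrite is_omegaE.
by split; [apply: ap_in hf h|apply: maps_ap (proj1 hf) h].
Qed.

Lemma playsE sigma (turn : V -> Prop) r : strategy sigma -> real r ->
  (forall n, turn n -> n ∈ om) ->
  plays sigma turn r <-> forall n, turn n -> ap r n = ap sigma (restr r n).
Proof.
move=> hs hr ht.
have H n : turn n -> maps sigma (restr r n) (ap sigma (restr r n)).
  move=> tn; apply: (proj2 (strategy_ap _ _ n hs (ht _ tn) _)).
  by apply: restr_function (proj1 (realE r) hr) (om_subset _ (ht _ tn)).
have [S [w [_ [_ [hf _]]]]] := hs.
split=> [h n tn|h n r' tn /is_restrictionE ->].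
  have [|k [h1 h2]] := h n (restr r n) tn; first exact/is_restrictionE.
  move/(real_maps _ _ _ hr): h2 => [_ <-].
  by rewrite -(maps_val _ _ _ _ hf h1).
exists (ap sigma (restr r n)); split; first exact: H.
by apply/real_maps => //; split; [apply: ht|rewrite h].
Qed.

(** The opponent's moves are taken from [w]; the entries of [w] at the strategy's own turns are
    overwritten. *)
Lemma run_exists sigma (turn : V -> Prop) w : strategy sigma -> def1 turn ->
  (forall n, turn n -> n ∈ om) -> real w ->
  exists r, real r /\ plays sigma turn r /\
    forall n, n ∈ om -> ~ turn n -> ap r n = ap w n.
Proof.
move=> hs dt ht hw.
have [||||r [fr H]] := recursion (fun n h v =>
  (turn n /\ v = ap sigma h) \/ (~ turn n /\ v = ap w n)) om om.
- by dtac.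
- exact: ord_om.
- move=> n h hn fh; have [tn|tn] := classic (turn n).
    exists (ap sigma h); split; last by left.
    by case: (strategy_ap _ _ n hs hn fh).
  by exists (ap w n); split; [apply: real_ap|right].
- by move=> n h v v' [[? ->]|[? ->]] [[? ->]|[? ->]].
have hr : real r by apply/realE.
exists r; split=> //; split; last by move=> n hn tn; case: (H n hn) => [[]|[]].
by apply/playsE => // n tn; case: (H n (ht _ tn)) => [[]|[]].
Qed.

Lemma constant_lipschitz z : real z ->
  exists F, lipschitz F /\ forall x, real x -> maps F x z.
Proof.
move=> hz.
have dF : fdef1 (fun _ : V => z) by dtac.
have hF (t : V) : t ∈ RR -> z ∈ RR by move=> _; apply/in_RR.
have f := lam_function _ _ _ dF hF.
exists (lam RR RR (fun _ => z)); split; last first.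
  move=> x /in_RR hx; have := maps_ap _ _ _ (proj1 f) hx.
  by rewrite ap_lam.
split; first by exists RR; split=> //; apply/is_realsE.
move=> x x' y y' n /(maps_apE _ _ _ _ (proj1 f)) [hx ->].
by move=> /(maps_apE _ _ _ _ (proj1 f)) [hy ->] _ _; rewrite !ap_lam.
Qed.

(** Induction on the position [m]. At odd positions the strategy sees equal histories; an even
    position is either [4k] with [k] in [N], where the inputs agree, or an ignored one, where both
    runs have [emp]. *)
Lemma odd_run_agree tau r r' N : strategy tau -> real r -> real r' ->
  plays tau odd r -> plays tau odd r' ->
  (forall m, m ∈ om -> ~ odd m -> (forall n, n ∈ om -> m <> ap ix n) ->
     ap r m = emp /\ ap r' m = emp) ->
  (forall k, k ∈ N -> k ∈ om -> ap r (ap ix k) = ap r' (ap ix k)) ->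
  forall m, m ∈ om -> (forall k, k ∈ om -> ole (ap ix k) m -> k ∈ N) ->
    ap r m = ap r' m.
Proof.
move=> ht hr hr' pr pr' dummy ag m hm.
move: (om_ord _ hm) (hm); move: m {hm}.
apply: (ord_ind (fun m => m ∈ om ->
  (forall k, k ∈ om -> ole (ap ix k) m -> k ∈ N) -> ap r m = ap r' m)).
  by dtac.
move=> m o IH hm H; have [od|nod] := classic (odd m).
  rewrite (proj1 (playsE _ _ _ ht hr odd_om) pr) //.
  rewrite (proj1 (playsE _ _ _ ht hr' odd_om) pr') //.
  have s := om_subset _ hm.
  move/realE: hr => fr; move/realE: hr' => fr'.
  have [f1 _] := restr_function _ _ _ _ fr s.
  have [f2 _] := restr_function _ _ _ _ fr' s.
  congr ap; apply: (fun_ext _ _ m) => // k hk.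
  rewrite (ap_restr _ _ _ _ _ fr s hk) (ap_restr _ _ _ _ _ fr' s hk).
  apply: IH => //; first exact: s.
  move=> i hi le; apply: H => //; left; exact: ole_lt_trans o le hk.
have [[k [hk E]]|nk] := classic (exists k, k ∈ om /\ m = ap ix k).
  by rewrite E; apply: ag => //; apply: H => //; right.
have [|-> ->] // := dummy m hm nod.
by move=> n hn E; apply: nk; exists n.
Qed.

(** Setting the ignored moves to [emp] leaves a single run against each [x], so [x] determines the
    part [z] and no run has to be chosen. *)
Lemma second_player_lipschitz tau : strategy tau ->
  exists F, lipschitz F /\ forall x, real x ->
    exists r, real r /\ plays tau odd r /\ cmp r ix = x /\
      maps F x (cmp r iz).
Proof.
move=> ht.
have hix := real_ix; have hiz := real_iz.
pose (Run := fun x r => real r /\ plays tau odd r /\ cmp r ix = x /\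
  forall m, m ∈ om -> ~ odd m -> (forall n, n ∈ om -> m <> ap ix n) ->
    ap r m = emp).
pose (P := fun x z => exists r, Run x r /\ z = cmp r iz).
have dP : def2 P by rewrite /P /Run /plays; dtac.
(* Used with [n = om] for uniqueness of [z] and with a natural [n] for the Lipschitz condition. *)
have main x z x' z' n : P x z -> P x' z' -> subset n om ->
    (forall k i, k ∈ n -> i ∈ k -> i ∈ n) ->
    (forall k, k ∈ n -> ap x k = ap x' k) ->
    forall k, k ∈ n -> ap z k = ap z' k.
  move=> [r [[hr [pr [Ex dr]]] ->]] [r' [[hr' [pr' [Ex' dr']]] ->]] s tr ag k hk.
  have hko := s _ hk.
  rewrite !ap_cmp //; apply: (odd_run_agree tau r r' n) => //.
  - by move=> m hm od nm; split; [apply: dr|apply: dr'].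
  - by move=> i hi hio; rewrite -!ap_cmp // Ex Ex'; apply: ag.
  - exact: real_ap.
  move=> i hi le.
  have : ole i k; last by case=> [/(tr _ _ hk)|->].
  apply: ix_lt_iz => //; case: le => // E.
  by case: (ix_neq_iz i k).
have ex x : x ∈ RR -> exists z, z ∈ RR /\ P x z.
  move/in_RR=> hx.
  (* The second slot of [merge] consists of positions of the strategy itself, so its filling [zero]
     does not affect the run; what matters is the default [emp] elsewhere. *)
  have [w [hw [Ew [_ dw]]]] := merge ix iz x zero hix hiz hx real_zero
    ix_inj iz_inj ix_neq_iz.
  have [r [hr [pr nr]]] := run_exists tau odd w ht def_odd odd_om hw.
  exists (cmp r iz); split; first by apply/in_RR; apply: real_cmp.
  exists r; split=> //; split=> //; split=> //; split.
    rewrite -Ew; apply: real_ext; try exact: real_cmp.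
    move=> n hn; rewrite (ap_cmp r) // (ap_cmp w) //; apply: nr; first exact: real_ap.
    by apply: even_not_odd; apply: even_ix.
  move=> m hm od nm; rewrite nr //; apply: dw => // n hn; split; first exact: nm.
  by move=> E; apply: od; rewrite E; apply: odd_iz.
have realP x z : P x z -> real z.
  by move=> [r [[hr _] ->]]; apply: real_cmp.
have un x z z' : x ∈ RR -> P x z -> P x z' -> z = z'.
  move=> hx Pz Pz'; apply: real_ext; [exact: realP Pz|exact: realP Pz'|].
  apply: (main x z x z' om) => // [k i hk hi]; exact: om_trans hk hi.
have f := graph_function RR RR P dP ex un.
exists (graph RR RR P); split; last first.
  move=> x hx; have hx' := hx; move/in_RR: hx' => /ex [z [hz Pz]].
  have [r [[hr [pr [Ex dr]]] E]] := Pz; exists r; split=> //; split=> //.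
  split=> //; rewrite -E; apply/maps_graph => //.
  by split=> //; apply/in_RR.
split; first by exists RR; split=> //; apply/is_realsE.
move=> x x' y y' n /(maps_graph _ _ _ dP) [hx [hx' Px]].
move=> /(maps_graph _ _ _ dP) [hy [hy' Py]] /in_om hn.
move/in_RR: hx => hx; move/in_RR: hx' => hx'.
move/in_RR: hy => hy; move/in_RR: hy' => hy'.
have s := om_subset _ hn.
move=> /(agreeE _ _ _ hx hy s) ag; apply/agreeE => //.
apply: (main x x' y y' n) => // k i hk hi.
by apply: ord_trans (om_ord _ hn) hi hk.
Qed.

(** * Regular cardinals *)

Section Regular.
Context (kappa : V) (hkappa : regular_cardinal kappa).
Implicit Types (D C : V).

Lemma ord_kappa : ordinal kappa.
Proof. by case: hkappa => [[]]. Qed.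

Lemma om_le_kappa : ole om kappa.
Proof. by case: hkappa => _ [[w [/is_omegaE ->]]]. Qed.

Lemma nat_in_kappa n : n ∈ om -> n ∈ kappa.
Proof. by move=> hn; apply: lt_ole_trans ord_kappa hn om_le_kappa. Qed.

Lemma regular_bound b f : b ∈ kappa -> function f b kappa ->
  exists c, c ∈ kappa /\ forall x, x ∈ b -> ap f x ∈ c.
Proof.
move=> hb hf; case: hkappa => _ [_ /(_ b f hb hf) [c [hc h]]].
exists c; split=> // x hx; apply: (h x); exact: maps_ap (proj1 hf) hx.
Qed.

(** Regularity for a function on 1: its single value [a] has a strict bound [c < kappa], and [suc a]
    is at most [c]. *)
Lemma kappa_suc a : a ∈ kappa -> suc a ∈ kappa.
Proof.
move=> ha; have ok := ord_kappa.
have d : fdef1 (fun _ : V => a) by dtac.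
have h1 : suc emp ∈ kappa by apply: nat_in_kappa; apply: om_suc; apply: om_emp.
have hF (t : V) : t ∈ suc emp -> a ∈ kappa by [].
have [c [hc h]] := regular_bound _ _ h1 (lam_function _ _ _ d hF).
have := h emp (in_suc_self _); rewrite ap_lam //; first exact: in_suc_self.
move=> hac; apply: (ole_lt_trans _ c) => //.
by apply: suc_le => //; [apply: ord_elem ok ha|apply: ord_elem ok hc].
Qed.

Lemma kappa_trans a b : b ∈ kappa -> a ∈ b -> a ∈ kappa.
Proof. by move=> hb ha; apply: ord_trans ord_kappa ha hb. Qed.

Lemma kappa_ord a : a ∈ kappa -> ordinal a.
Proof. exact: ord_elem ord_kappa. Qed.

(** Least witnesses form a function on [b]. Its strict bound below [kappa] works for every [x],
    since [W] is preserved upwards. *)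
Lemma regular_collect (W : V -> V -> Prop) b : def2 W -> b ∈ kappa ->
  (forall x c c', c ∈ kappa -> c' ∈ kappa -> c ∈ c' -> W x c -> W x c') ->
  (forall x, x ∈ b -> exists c, c ∈ kappa /\ W x c) ->
  exists c, c ∈ kappa /\ forall x, x ∈ b -> W x c.
Proof.
move=> dW hb up ex; have ok := ord_kappa.
pose (L := fun x c => c ∈ kappa /\ W x c /\ forall d, d ∈ c -> ~ W x d).
have dL : def2 L by rewrite /L; dtac.
have Lex x : x ∈ b -> exists c, c ∈ kappa /\ L x c.
  move=> /ex [c [hc h]].
  have [|||u [ou [[hu Wu] m]]] := ord_least (fun c => c ∈ kappa /\ W x c) c.
  - by dtac.
  - exact: kappa_ord.
  - by [].
  exists u; split=> //; split=> //; split=> // d hd Wd; apply: (m d hd).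
  by split=> //; apply: kappa_trans hu hd.
have Lun x c c' : x ∈ b -> L x c -> L x c' -> c = c'.
  move=> _ [hc [Wc m]] [hc' [Wc' m']].
  by case: (ord_total c c'); [exact: kappa_ord|exact: kappa_ord|move=> /m'|
     case=> // /m].
have [c [hc h]] := regular_bound _ _ hb (graph_function b kappa L dL Lex Lun).
exists c; split=> // x hx.
have [h1 [h2 _]] := graph_ap b kappa L x dL Lex Lun hx.
exact: up h1 hc (h _ hx) h2.
Qed.

Lemma kappa_club : club kappa kappa.
Proof.
split=> //; split=> // a ha; exists (suc a); split; first exact: kappa_suc.
exact: in_suc_self.
Qed.

(* An [omega]-chain of closure steps has its supremum below [kappa] because
   [omega < kappa] is regular. *)
Lemma closure_club (W : V -> V -> V -> Prop) : def3 W -> om ∈ kappa ->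
  (forall b d c c', c ∈ kappa -> c' ∈ kappa -> c ∈ c' -> W b d c -> W b d c') ->
  (forall b d, b ∈ kappa -> d ∈ kappa -> exists c, c ∈ kappa /\ W b d c) ->
  exists C, club C kappa /\
    forall c, c ∈ C -> forall b d, b ∈ c -> d ∈ c -> W b d c.
Proof.
move=> dW hom up ex; have ok := ord_kappa.
pose (Q := fun c => forall b d, b ∈ c -> d ∈ c -> W b d c).
have dQ : def1 Q by rewrite /Q; dtac.
have ub b : b ∈ kappa -> exists c, c ∈ kappa /\
    forall x y, x ∈ b -> y ∈ b -> W x y c.
  move=> hb.
  have [||||c [hc H]] := regular_collect (fun x c => forall y, y ∈ b -> W x y c) b.
  - by dtac.
  - by [].
  - move=> x c c' hc hc' lt H y hy; exact: up hc hc' lt (H y hy).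
  - move=> x hx; apply: regular_collect => //; first by dtac.
      by move=> y c c'; apply: up.
    by move=> y hy; apply: ex; [apply: kappa_trans hb hx|apply: kappa_trans hb hy].
  by exists c; split=> // x y hx hy; apply: H.
exists (sep kappa Q); split; last by move=> c; rewrite in_sep // => - [].
split; first by move=> c; rewrite in_sep // => - [].
split; last first.
  (* Two points below the limit [d] lie below one member [c < d] of the set; [W] holds there and
     passes up to [d]. *)
  move=> d hd ld H; apply/in_sep => //; split=> // x y hx hy.
  have od := kappa_ord _ hd.
  have [m [hm [lx ly]]] := ord_max x y (ord_elem _ _ od hx) (ord_elem _ _ od hy).
  have hmd : m ∈ d by case: hm => ->.
  have [c [/in_sep [] // hc Qc [hcd hmc]]] := H _ hmd.
  have oc := kappa_ord _ hc.
  apply: (up _ _ c) => //; apply: Qc; first exact: ole_lt_trans oc lx hmc.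
  exact: ole_lt_trans oc ly hmc.
move=> a ha.
have [|||||| s [fs H]] := sequence (fun c => a ∈ c)
  (fun d c => d ∈ c /\ forall x y, x ∈ d -> y ∈ d -> W x y c) kappa om.
- by dtac.
- by dtac.
- by [].
- exact: ord_om.
- by move=> b f hb; apply: regular_bound; apply: kappa_trans hom hb.
- move=> b hb; have [c [hc Hc]] := ub b hb.
  have osb := kappa_suc _ hb; have osa := kappa_suc _ ha.
  (* [g] becomes the maximum of [c], [b] and [a]. Its successor exceeds [a] and all of [b], and
     inherits [W] from [c]. *)
  have [e [he [le1 le2]]] := ord_max c b (kappa_ord _ hc) (kappa_ord _ hb).
  have hek : e ∈ kappa by case: he => ->.
  have [g [hg [lg1 lg2]]] := ord_max e a (kappa_ord _ hek) (kappa_ord _ ha).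
  have hgk : g ∈ kappa by case: hg => ->.
  have osg := kappa_suc _ hgk.
  have ogg := kappa_ord _ hgk.
  exists (suc g); split=> //; split; first exact/lt_suc.
  have lbg : ole b g by apply: ole_trans ogg le2 lg1.
  have lcg : ole c g by apply: ole_trans ogg le1 lg1.
  move=> d hd; split.
    by apply/lt_suc; left; apply: lt_ole_trans ogg hd lbg.
  move=> x y hx hy; apply: (up _ _ c) => //; first exact/lt_suc.
  have ob := kappa_ord _ hb.
  by apply: Hc; apply: ord_trans ob _ hd.
have [b [hb sb]] := regular_bound _ _ hom fs.
have sk n : n ∈ om -> ap s n ∈ kappa by move=> hn; apply: ap_in fs hn.
(* [E] is the supremum of the chain, obtained as the union of its terms inside the bound [b]. *)
pose (E := sep b (fun x => exists n, n ∈ om /\ x ∈ ap s n)).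
have inE x : x ∈ E <-> exists n, n ∈ om /\ x ∈ ap s n.
  rewrite in_sep; first by dtac.
  split=> [[]|[n [hn hx]]] //; split; last by exists n.
  exact: ord_trans (kappa_ord _ hb) hx (sb _ hn).
have oE : ordinal E.
  split=> [x /inE [n [hn hx]] y hy|x /inE [n [hn hx]]].
    apply/inE; exists n; split=> //.
    by apply: ord_trans (kappa_ord _ (sk _ hn)) hy hx.
  by case: (ord_elem _ _ (kappa_ord _ (sk _ hn)) hx).
have hE : E ∈ kappa.
  have ob := kappa_ord _ hb.
  apply: (ole_lt_trans _ b) => //; case: (ole_total _ _ oE ob) => //.
  rewrite /E in_sep; first by dtac.
  by case=> /mem_irrefl.
have mono n m : m ∈ om -> n ∈ m -> ap s n ∈ ap s m.
  by move=> hm hn; case: (H m hm) => _ /(_ n hn) [].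
exists E; split; last by apply/inE; exists emp; split; [|case: (H emp om_emp)];
  try exact: om_emp.
apply/in_sep => //; split=> // x y /inE [n [hn hx]] /inE [m [hm hy]].
have [l [hl [ln lm]]] := ord_max n m (om_ord _ hn) (om_ord _ hm).
have hlo : l ∈ om by case: hl => ->.
have ol := kappa_ord _ (sk _ hlo).
have hx' : x ∈ ap s l.
  case: ln => [/(mono _ _ hlo) lt|<-] //; exact: ord_trans ol hx lt.
have hy' : y ∈ ap s l.
  case: lm => [/(mono _ _ hlo) lt|<-] //; exact: ord_trans ol hy lt.
(* Pairs from [s(l)] satisfy [W] at [s(l + 1)], which is below [E] because [s(l + 2)] is larger
   still. *)
have hsl := om_suc _ hlo.
apply: (up _ _ (ap s (suc l))) => //; first exact: sk.
  by apply/inE; exists (suc (suc l)); split; [apply: om_suc|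
    apply: mono; [apply: om_suc|apply: in_suc_self]].
by case: (H _ hsl) => _ /(_ l (in_suc_self _)) [_]; apply.
Qed.

Lemma increasing_exists C a : ordinal a -> ole a kappa -> club C kappa ->
  exists f, increasing C a f.
Proof.
move=> oa ha [sC [uC _]]; have ok := ord_kappa.
have [||||||f [hf H]] := sequence (fun c => c ∈ C) (fun d c => d ∈ c) kappa a.
- by dtac.
- by dtac.
- by [].
- by [].
- move=> b g hb; apply: regular_bound; exact: lt_ole_trans ok hb ha.
- move=> b /uC [c [hc hbc]]; exists c; split; first exact: sC.
  by split=> // d hd; apply: ord_trans (kappa_ord _ (sC _ hc)) hd hbc.
have fC : function f a C.
  case: hf => ff _; split=> // b c.
  by move/(maps_apE _ _ _ _ ff) => [/H [hb _] ->].
exists f; split=> // b c u v hbc.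
move/(maps_apE _ _ _ _ (proj1 hf)) => [hb ->].
by move/(maps_apE _ _ _ _ (proj1 hf)) => [/H [_ hc] ->]; apply: hc.
Qed.

(** If [f(b) < b], then [f(f(b)) < f(b)], against the induction hypothesis at [f(b)]. *)
Lemma increasing_ge C a f : ordinal a -> subset C kappa -> increasing C a f ->
  forall b, b ∈ a -> ole b (ap f b).
Proof.
move=> oa sC [hf inc] b hb; move: (ord_elem _ _ oa hb) (hb); move: b {hb}.
apply: ord_ind; first by dtac.
move=> b ob IH hb.
have oc := kappa_ord _ (sC _ (ap_in _ _ _ _ hf hb)).
case: (ole_total _ _ ob oc) => // lt.
have hd := ord_trans _ _ _ oa lt hb.
have h : ap f (ap f b) ∈ ap f b.
  by apply: (inc _ _ _ _ lt); apply: (maps_ap _ a) => //; case: hf.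
by case: (ole_not_lt _ _ (ord_elem _ _ oc h) (IH _ lt hd)).
Qed.

End Regular.

(** * Good coding systems *)

Section Coding.
Context (kappa theta Gamma decode GC : V)
  (hcoding : good_coding_system kappa theta Gamma decode GC).
Implicit Types (beta gamma delta eta T : V).

Let hkappa : regular_cardinal kappa := gcs_regular _ _ _ _ _ hcoding.
Let otheta : ordinal theta := gcs_ordinal _ _ _ _ _ hcoding.

Lemma theta_in_kappa beta : beta ∈ theta -> beta ∈ kappa.
Proof.
move=> h; exact: lt_ole_trans (ord_kappa _ hkappa) h (gcs_le _ _ _ _ _ hcoding).
Qed.

Lemma decode_function : exists P, function decode RR P /\
  forall d, d ∈ P <-> subset d (prod theta kappa).
Proof.
have [R0 [Q [P [/is_realsE -> [/is_prodE -> [hP hf]]]]]] :=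
  gcs_decode _ _ _ _ _ hcoding.
by exists P.
Qed.

Lemma decodeE x d : real x -> maps decode x d <-> d = ap decode x.
Proof.
have [P [[hf _] _]] := decode_function; move=> hx.
by rewrite (maps_apE _ _ _ _ hf) in_RR; tauto.
Qed.

Lemma GC_family : function_on GC (prod theta kappa).
Proof. by have [Q [/is_prodE ->]] := gcs_family _ _ _ _ _ hcoding. Qed.

Lemma in_GC_atE beta gamma x : beta ∈ theta -> gamma ∈ kappa ->
  in_GC_at GC beta gamma x <-> x ∈ ap GC (opair beta gamma).
Proof.
move=> hb hg; have hf := GC_family.
have hp : opair beta gamma ∈ prod theta kappa.
  by apply/in_prod; exists beta, gamma.
split=> [[G [[p [/is_opairE -> h]] hx]]|hx].
  by rewrite -(maps_val _ _ _ _ hf h).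
exists (ap GC (opair beta gamma)); split=> //.
exists (opair beta gamma); rewrite is_opairE; split=> //.
exact: maps_ap hf hp.
Qed.

Lemma GC_Delta beta gamma : beta ∈ theta -> gamma ∈ kappa ->
  in_Delta Gamma (ap GC (opair beta gamma)).
Proof.
move=> hb hg; apply: (gcs_Delta _ _ _ _ _ hcoding beta gamma) => //.
exists (opair beta gamma); rewrite is_opairE; split=> //.
by apply: maps_ap GC_family _; apply/in_prod; exists beta, gamma.
Qed.

Lemma in_GC_at_real beta gamma x : beta ∈ theta -> gamma ∈ kappa ->
  in_GC_at GC beta gamma x -> real x.
Proof.
move=> hb hg /(in_GC_atE _ _ _ hb hg) hx.
have [h _] := GC_Delta _ _ hb hg.
exact: (gcs_pointclass _ _ _ _ _ hcoding _ h).
Qed.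

Lemma in_GC_at_decode beta gamma x f u : beta ∈ theta -> gamma ∈ kappa ->
  real x -> maps decode x f -> in_GC_at GC beta gamma x -> u ∈ kappa ->
  maps f beta u -> u = gamma.
Proof.
move=> hb hg hx /(decodeE _ _ hx) -> /(gcs_GC _ _ _ _ _ hcoding _ _ _ hb hg hx).
move=> [d [/(decodeE _ _ hx) -> [_ h]]]; exact: h.
Qed.

Lemma decode_GC x f : real x -> maps decode x f -> function f theta kappa ->
  forall beta, beta ∈ theta -> in_GC_at GC beta (ap f beta) x.
Proof.
move=> hx hd hf beta hb.
apply/(gcs_GC _ _ _ _ _ hcoding) => //; first exact: ap_in hf hb.
exists f; split=> //; split; first exact: maps_ap (proj1 hf) hb.
by move=> g hg /(maps_val _ _ _ _ (proj1 hf)).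
Qed.

Lemma decode_value x f beta u : real x -> maps decode x f -> maps f beta u ->
  beta ∈ theta /\ u ∈ kappa.
Proof.
move=> hx /(decodeE _ _ hx) -> /mapsE h.
have [P [hf hP]] := decode_function.
have /hP s : ap decode x ∈ P by apply: ap_in hf _; apply/in_RR.
by move: (s _ h) => /in_prod [a [b [ha [hb /opair_inj [-> ->]]]]].
Qed.

(** ** The pointclass Delta *)

(** Membership in Delta for classes, judged on reals only; this lets Delta sets be handled through
    the logical form of their definitions. *)
Definition Del (P : V -> Prop) : Prop :=
  exists A, in_Delta Gamma A /\ forall x, x ∈ A <-> real x /\ P x.

Lemma Del_ext (P Q : V -> Prop) :
  (forall x, real x -> (P x <-> Q x)) -> Del P -> Del Q.
Proof.
move=> E [A [hA H]]; exists A; split=> // x; rewrite H.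
by split=> - [hx h]; split=> //; apply/E.
Qed.

Lemma Del_intro (P : V -> Prop) A B : A ∈ Gamma -> B ∈ Gamma ->
  (forall x, x ∈ A <-> real x /\ P x) -> (forall x, x ∈ B <-> real x /\ ~ P x) ->
  Del P.
Proof.
move=> hA hB EA EB; exists A; split=> //; split=> //; exists B; split=> // x.
rewrite EA EB; split=> - [hx h]; split=> //; tauto.
Qed.

Lemma Del_elim (P : V -> Prop) : Del P -> exists A B, A ∈ Gamma /\ B ∈ Gamma /\
  (forall x, x ∈ A <-> real x /\ P x) /\ (forall x, x ∈ B <-> real x /\ ~ P x).
Proof.
move=> [A [[hA [B [hB EB]]] EA]]; exists A, B; split=> //; split=> //; split=> // x.
have hx' : x ∈ B -> real x by apply: (gcs_pointclass _ _ _ _ _ hcoding).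
split=> [h|[hx n]].
  have hx := hx' h; split=> // hP.
  by have /EB [] : x ∈ A by apply/EA.
apply: NNPP => nB; apply: n.
by have /EA [] : x ∈ A by apply/EB.
Qed.

Lemma Del_not (P : V -> Prop) : Del P -> Del (fun x => ~ P x).
Proof.
move=> /Del_elim [A [B [hA [hB [EA EB]]]]].
apply: (Del_intro _ B A) => // x; rewrite EA.
by split=> - [hx h]; split=> //; tauto.
Qed.

(** Each set of the union is determined by its index through extensionality, so the sequence
    required by [gcs_unions] is formed without choice. *)
Lemma Del_ex b (P : V -> V -> Prop) : def2 P -> b ∈ kappa ->
  (forall a, a ∈ b -> Del (P a)) -> Del (fun x => exists a, a ∈ b /\ P a x).
Proof.
move=> dP hb H.
pose (Q := fun a B => forall x, x ∈ B <-> real x /\ P a x).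
have dQ : def2 Q by rewrite /Q; dtac.
have Qex a : a ∈ b -> exists B, B ∈ Gamma /\ Q a B.
  by move/H => [A [[hA _] E]]; exists A.
have Qun a B B' : a ∈ b -> Q a B -> Q a B' -> B = B'.
  by move=> _ h h'; apply: set_ext => x; rewrite h h'.
have [hf _] := graph_function b Gamma Q dQ Qex Qun.
pose (U := sep RR (fun x => exists a, a ∈ b /\ P a x)).
have inU x : x ∈ U <-> real x /\ exists a, a ∈ b /\ P a x.
  by rewrite in_sep ?in_RR //; dtac.
exists U; split=> //.
apply: (gcs_unions _ _ _ _ _ hcoding b (graph b Gamma Q)) => //.
  move=> a B /(maps_graph _ _ _ dQ) [ha [_ q]].
  have [A [hA E]] := H a ha; suff -> : B = A by [].
  by apply: set_ext => x; rewrite q E.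
move=> x; rewrite inU; split.
  move=> [hx [a [ha p]]]; have [B [hB q]] := Qex a ha.
  exists a, B; split; first by apply/maps_graph.
  by apply/q.
move=> [a [B [/(maps_graph _ _ _ dQ) [ha [_ q]] /q [hx p]]]].
by split=> //; exists a.
Qed.

Lemma Del_all b (P : V -> V -> Prop) : def2 P -> b ∈ kappa ->
  (forall a, a ∈ b -> Del (P a)) -> Del (fun x => forall a, a ∈ b -> P a x).
Proof.
move=> dP hb H.
have := Del_not _ (Del_ex b (fun a x => ~ P a x) _ hb _).
move=> D; apply: Del_ext (D _ _) => [x hx||a ha]; last by apply/Del_not/H.
  split=> [n a ha|h [a [ha n]]]; last by apply: n; apply: h.
  by apply: NNPP => np; apply: n; exists a.
by dtac.
Qed.

(** A conjunction is treated as an intersection of length 2, hence reduced to wellordered unions and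
    complements: index [emp] stands for [P], the other index for [Q]. *)
Lemma Del_and (P Q : V -> Prop) : Del P -> Del Q -> Del (fun x => P x /\ Q x).
Proof.
move=> DP DQ; have [A [_ EA]] := DP; have [B [_ EB]] := DQ.
have h2 : suc (suc emp) ∈ kappa.
  by apply: nat_in_kappa hkappa _ _; apply/om_suc/om_suc/om_emp.
apply: (Del_ext (fun x => forall a, a ∈ suc (suc emp) ->
  (a = emp -> x ∈ A) /\ (a <> emp -> x ∈ B))).
  move=> x hx; split=> [h|[p q] a _]; last by rewrite EA EB.
  split.
    have /h [/(_ eq_refl) /EA []] // : emp ∈ suc (suc emp).
    by apply/in_suc; left; apply: in_suc_self.
  have /h [_ H] := in_suc_self (suc emp).
  by case/EB: (H (suc_neq_emp _)).
apply: Del_all => //; first by dtac.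
move=> a _; have [E|n] := classic (a = emp).
  by apply: Del_ext DP => x hx; rewrite EA; tauto.
by apply: Del_ext DQ => x hx; rewrite EB; tauto.
Qed.

Lemma Del_continuous F A : function F RR RR -> continuous F ->
  Del (fun x => x ∈ A) -> Del (fun x => ap F x ∈ A).
Proof.
move=> fF cF /Del_elim [A1 [A2 [h1 [h2 [E1 E2]]]]].
pose (B1 := sep RR (fun x => ap F x ∈ A)).
pose (B2 := sep RR (fun x => ~ ap F x ∈ A)).
have in1 x : x ∈ B1 <-> real x /\ ap F x ∈ A.
  by rewrite in_sep ?in_RR //; dtac.
have in2 x : x ∈ B2 <-> real x /\ ~ ap F x ∈ A.
  by rewrite in_sep ?in_RR //; dtac.
have rF x : real x -> real (ap F x).
  by move=> /in_RR hx; apply/in_RR; apply: ap_in fF hx.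
apply: (Del_intro _ B1 B2) => //; apply: (gcs_substitution _ _ _ _ _ hcoding F);
  [exact: cF|exact: h1| |exact: cF|exact: h2|].
- move=> x; rewrite in1; split=> [[hx h]|[y [h hy]]].
    exists (ap F x); rewrite E1; split; last by split=> //; apply: rF.
    by apply/(maps_apE _ _ _ _ (proj1 fF)); rewrite in_RR.
  move/(maps_apE _ _ _ _ (proj1 fF)): h => [hx E].
  by split; [apply/in_RR|rewrite -E; case/E1: hy].
- move=> x; rewrite in2; split=> [[hx h]|[y [h hy]]].
    exists (ap F x); rewrite E2; split; last by split=> //; apply: rF.
    by apply/(maps_apE _ _ _ _ (proj1 fF)); rewrite in_RR.
  move/(maps_apE _ _ _ _ (proj1 fF)): h => [hx E].
  by split; [apply/in_RR|rewrite -E; case/E2: hy].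
Qed.

Lemma continuous_intro F : function F RR RR ->
  (forall x n, real x -> n ∈ om -> exists m, m ∈ om /\ forall y, real y ->
     (forall k, k ∈ m -> ap x k = ap y k) ->
     forall k, k ∈ n -> ap (ap F x) k = ap (ap F y) k) -> continuous F.
Proof.
move=> fF H; split; first by exists RR; rewrite is_realsE.
have rF x : real x -> real (ap F x).
  by move=> /in_RR hx; apply/in_RR; apply: ap_in fF hx.
move=> x x' n /(maps_apE _ _ _ _ (proj1 fF)) [/in_RR hx ->] /in_om hn.
have [m [hm h]] := H x n hx hn; exists m; split; first exact/in_om.
move=> y y' /(maps_apE _ _ _ _ (proj1 fF)) [/in_RR hy ->].
move/(agreeE _ _ _ hx hy (om_subset _ hm)) => ag.
apply/agreeE; [exact: rF|exact: rF|exact: om_subset|].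
exact: h.
Qed.

Lemma Del_cmp j (P : V -> Prop) : real j -> Del P -> Del (fun x => P (cmp x j)).
Proof.
move=> hj DP; have [A [_ EA]] := DP.
have dF : fdef1 (fun x => cmp x j) by dtac.
have hF x : x ∈ RR -> cmp x j ∈ RR.
  by rewrite !in_RR => hx; apply: real_cmp.
have fF := lam_function _ _ _ dF hF.
have DA : Del (fun x => x ∈ A).
  by apply: Del_ext DP => x hx; rewrite EA; tauto.
apply: Del_ext (Del_continuous _ A fF _ DA) => [x hx|].
  rewrite ap_lam //; first exact/in_RR.
  by rewrite EA; split=> [[]|h] //; split=> //; apply: real_cmp.
apply: continuous_intro => // x n hx hn.
have [m [hm h]] := om_bound j n hn (proj1 (realE j) hj).
exists m; split=> // y hy ag k hk.
have hko := om_trans _ _ hn hk.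
have E z : real z -> ap (lam RR RR (fun x => cmp x j)) z = cmp z j.
  by move=> /in_RR hz; apply: ap_lam.
by rewrite !E // !ap_cmp //; apply: ag; apply: h.
Qed.

Hypothesis theta_nonempty : exists beta, beta ∈ theta.

(* Some GC_{beta,gamma} is neither empty nor everything, so every clopen set is
   its preimage under a two-valued continuous function. *)
Lemma Del_clopen (P : V -> Prop) m : def1 P -> m ∈ om ->
  (forall x y, real x -> real y -> (forall k, k ∈ m -> ap x k = ap y k) ->
     P x -> P y) -> Del P.
Proof.
move=> dP hm HP; have [beta hb] := theta_nonempty.
have h0 := nat_in_kappa _ hkappa _ om_emp.
have h1 := nat_in_kappa _ hkappa _ (om_suc _ om_emp).
have code c : c ∈ kappa -> exists x, real x /\
    forall gamma, gamma ∈ kappa -> in_GC_at GC beta gamma x <-> gamma = c.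
  move=> hc; have dF : fdef1 (fun _ : V => c) by dtac.
  have hF (t : V) : t ∈ theta -> c ∈ kappa by [].
  have fF := lam_function _ _ _ dF hF.
  have [x [hx hd]] := gcs_decode_onto _ _ _ _ _ hcoding _ fF.
  have := decode_GC _ _ hx hd fF _ hb; rewrite ap_lam // => hg.
  exists x; split=> // gamma hgk; split=> [h|->] //; symmetry.
  apply: (in_GC_at_decode beta _ x _ c hb hgk hx hd h hc).
  by apply/(maps_apE _ _ _ _ (proj1 fF)); rewrite ap_lam.
(* [a] codes the constant function 0 and [b] the constant function 1, so [G] separates them. *)
have [a [ha Ha]] := code _ h0; have [b [hb' Hb]] := code _ h1.
pose (G := ap GC (opair beta emp)).
have aG : a ∈ G by apply/in_GC_atE => //; apply/Ha.
have bG : ~ b ∈ G.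
  move=> /(in_GC_atE _ _ _ hb h0) /(Hb _ h0) E.
  by apply: (suc_neq_emp emp).
have DG : Del (fun x => x ∈ G).
  exists G; split; first exact: GC_Delta.
  move=> x; split=> [h|[]] //; split=> //.
  by apply: (in_GC_at_real beta emp) => //; apply/in_GC_atE.
pose (Q := fun x y => (P x /\ y = a) \/ (~ P x /\ y = b)).
have dQ : def2 Q by rewrite /Q; dtac.
have Qex x : x ∈ RR -> exists y, y ∈ RR /\ Q x y.
  move=> _; have [p|p] := classic (P x).
    by exists a; rewrite in_RR; split=> //; left.
  by exists b; rewrite in_RR; split=> //; right.
have Qun x y y' : x ∈ RR -> Q x y -> Q x y' -> y = y'.
  by move=> _ [[p ->]|[p ->]] [[p' ->]|[p' ->]].
have fF := graph_function RR RR Q dQ Qex Qun.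
have vF x : real x -> Q x (ap (graph RR RR Q) x).
  by move=> /in_RR; apply: graph_ap.
apply: Del_ext (Del_continuous _ G fF _ DG) => [x hx|].
  by case: (vF x hx) => - [p ->]; tauto.
apply: continuous_intro => // x n hx hn; exists m; split=> // y hy ag k hk.
suff -> : ap (graph RR RR Q) x = ap (graph RR RR Q) y by [].
have iff : P x <-> P y.
  split; apply: HP => // i hi; by symmetry; apply: ag.
by case: (vF x hx) => - [p ->]; case: (vF y hy) => - [p' ->] //; tauto.
Qed.

Hypothesis om_lt_kappa : om ∈ kappa.

(** A closed condition, as an intersection of [om] clopen ones, each of which inspects two entries
    of [s]; the length is admissible because [om] is below [kappa]. *)
Lemma Del_eq a b : real a -> real b ->
  Del (fun s => forall n, n ∈ om -> ap s (ap a n) = ap s (ap b n)).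
Proof.
move=> ha hb; apply: Del_all => //; first by dtac.
move=> n hn; have hna := real_ap _ _ ha hn; have hnb := real_ap _ _ hb hn.
have [c [hc [h1 h2]]] := ord_max _ _ (om_ord _ hna) (om_ord _ hnb).
have hco : c ∈ om by case: hc => ->.
apply: (Del_clopen _ (suc c)); first by dtac.
  exact: om_suc.
move=> x y hx hy ag; rewrite !ag //; exact/lt_suc.
Qed.

(** Following a strategy is a closed condition: what is required at turn [n] depends on the entries
    up to [n] only. *)
Lemma Del_plays sigma (turn : V -> Prop) : strategy sigma -> def1 turn ->
  (forall n, turn n -> n ∈ om) -> Del (plays sigma turn).
Proof.
move=> hs dt ht.
apply: (Del_ext (fun r => forall n, n ∈ om -> turn n ->
  ap r n = ap sigma (restr r n))).
  move=> r hr; rewrite playsE //; split=> h n; last by move=> _; apply: h.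
  by move=> tn; apply: h => //; apply: ht.
apply: Del_all => //; first by dtac.
move=> n hn; apply: (Del_clopen _ (suc n)); first by dtac.
  exact: om_suc.
move=> x y hx hy ag H tn; rewrite -ag; first exact: in_suc_self.
rewrite H //; congr ap.
have s := om_subset _ hn; move/realE: hx => fx; move/realE: hy => fy.
have [f1 _] := restr_function _ _ _ _ fx s.
have [f2 _] := restr_function _ _ _ _ fy s.
apply: (fun_ext _ _ n) => // k hk.
rewrite (ap_restr _ _ _ _ _ fx s hk) (ap_restr _ _ _ _ _ fy s hk).
by apply: ag; apply/in_suc; left.
Qed.

(** This turns the join used by the real quantifier into reindexing along [2n] and [2n + 1], so that
    [Del_cmp] and [Del_eq] apply to its halves. *)
Lemma joinE x y z : real x -> real y -> is_join x y z <->
  real z /\ cmp z dbl = x /\ cmp z (nxt dbl) = y.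
Proof.
move=> hx hy; have hd := real_dbl; have hn' := real_nxt _ hd.
split=> [[hz H]|[hz [Ex Ey]]].
  have K n : n ∈ om -> ap x n = ap z (ap dbl n) /\ ap y n = ap z (suc (ap dbl n)).
    move=> hn; have [|||A B] := H n (ap dbl n) (suc (ap dbl n)).
    - exact/in_om.
    - exact/doubleE.
    - exact/is_succE.
    have /A /(real_maps _ _ _ hz) [_ <-] : maps x n (ap x n) by apply/real_maps.
    by have /B /(real_maps _ _ _ hz) [_ <-] : maps y n (ap y n) by apply/real_maps.
  split=> //; split; apply: real_ext => //; try exact: real_cmp; move=> n hn.
    by rewrite ap_cmp //; case: (K n hn).
  by rewrite ap_cmp // ap_nxt //; case: (K n hn).
split=> // n d d' /in_om hn /(doubleE _ _ hn) -> /is_succE ->.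
have h1 := dbl_om _ hn; have h2 := om_suc _ h1.
rewrite -Ex -Ey; split=> k; rewrite !real_maps //; try exact: real_cmp.
  by rewrite ap_cmp //; tauto.
by rewrite ap_cmp // ap_nxt //; tauto.
Qed.

(** ** Boundedness along a closed set of runs *)

Section Bounding.
(** [T] stands for the runs of a strategy, [p] lists the positions of the opponent's code and [q]
    those of the code played by the strategy. Leaving [p] and [q] open covers both players at
    once. *)
Context (T p q : V).
Hypothesis (hp : real p) (hq : real q).
Hypothesis DT : Del (fun r => r ∈ T).
Hypothesis T_real : forall r, r ∈ T -> real r.
Hypothesis T_rows : forall r beta, r ∈ T -> beta ∈ theta ->
  (forall beta', beta' ∈ suc beta -> in_GC_row kappa GC beta' (cmp r p)) ->
  in_GC_row kappa GC beta (cmp r q).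

Definition rows_le beta delta x : Prop := forall beta', beta' ∈ suc beta ->
  exists gamma, gamma ∈ suc delta /\ in_GC_at GC beta' gamma x.

Definition Bd beta delta eta : Prop := forall r, r ∈ T ->
  rows_le beta delta (cmp r p) ->
  exists gamma, gamma ∈ eta /\ in_GC_at GC beta gamma (cmp r q).

Lemma bound_exists beta delta : beta ∈ theta -> delta ∈ kappa ->
  exists eta, eta ∈ kappa /\ Bd beta delta eta.
Proof.
move=> hb hd.
have hbk := theta_in_kappa _ hb.
have hsb := kappa_suc _ hkappa _ hbk.
have hsd := kappa_suc _ hkappa _ hd.
have sub beta' : beta' ∈ suc beta -> beta' ∈ theta.
  by move=> /lt_suc h; apply: ole_lt_trans otheta h hb.
have subd gamma : gamma ∈ suc delta -> gamma ∈ kappa.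
  by apply: kappa_trans hkappa _ _ hsd.
have dRl : def1 (rows_le beta delta) by rewrite /rows_le; dtac.
(* An intersection of length [suc beta] of unions of length [suc delta], both below [kappa]. *)
have DR : Del (rows_le beta delta).
  apply: Del_all => //; first by dtac.
  move=> beta' /sub hb'; apply: Del_ex => //; first by dtac.
  move=> gamma /subd hg; exists (ap GC (opair beta' gamma)).
  split; first exact: GC_Delta.
  move=> x; rewrite -in_GC_atE //; split=> [h|[]] //; split=> //.
  exact: in_GC_at_real h.
have hdb := real_dbl; have hnx := real_nxt _ hdb.
(* The set lives on joins [s] of [x] and [r]. The run [r] is read at odd positions, and the last
   conjunct expresses [x = cmp r q], that is, [s(2n) = s(2 q(n) + 1)]. *)
have := Del_and _ _ (Del_and _ _ (Del_cmp _ _ hnx DT)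
    (Del_cmp _ _ hnx (Del_cmp _ _ hp DR)))
  (Del_eq dbl (cmp (nxt dbl) q) hdb (real_cmp _ _ hnx hq)).
move=> [B [DB EB]].
pose (A := sep RR (fun x => exists r, r ∈ T /\ rows_le beta delta (cmp r p) /\
  x = cmp r q)).
have inA x : x ∈ A <-> real x /\
    exists r, r ∈ T /\ rows_le beta delta (cmp r p) /\ x = cmp r q.
  by rewrite in_sep ?in_RR //; dtac.
have [|x|eta [he H]] := gcs_boundedness _ _ _ _ _ hcoding beta A hb.
- exists B; split=> // x; rewrite inA; split=> - [hx]; last first.
    move=> [y [z [hy [/(joinE _ _ _ hx hy) [hz [Ex Ey]] /EB [_ [[zT zR] zE]]]]]].
    split=> //; exists y; rewrite -{1 2}Ey; split=> //; split=> //.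
    rewrite -Ex -Ey; apply: real_ext; try by do ?apply: real_cmp.
    move=> n hn; rewrite (ap_cmp z) // zE // ap_cmp //.
    have hqn := real_ap _ _ hq hn.
    by rewrite ap_cmp ?ap_cmp //; apply: real_cmp.
  move=> [r [rT [rR Ex]]]; split=> //; have hr := T_real _ rT.
  have [|||s [hs [Es [Es' _]]]] := merge dbl (nxt dbl) x r hdb hnx hx hr.
  + exact: dbl_inj.
  + move=> n m hn hm; rewrite !ap_nxt // => E; apply: dbl_inj => //.
    by apply: suc_inj E; apply: om_ord; apply: dbl_om.
  + by move=> n m hn hm; rewrite ap_nxt //; apply: dbl_neq_suc.
  exists r, s; split=> //; split; first exact/joinE.
  apply/EB; rewrite Es'; split=> //; split=> // n hn.
  have hqn := real_ap _ _ hq hn.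
  have := ap_cmp s dbl n hs hdb hn; rewrite Es Ex => <-.
  rewrite ap_cmp // ap_cmp // -(ap_cmp s) // ?Es' //.
- move=> /inA [hx [r [rT [rR ->]]]]; apply: T_rows => // beta' /rR.
  by move=> [gamma [/subd hg h]]; exists gamma.
exists eta; split=> // r rT rR; apply: H; apply/inA; split; last by exists r.
by apply: real_cmp => //; apply: T_real.
Qed.

Lemma bounding_club : exists C, club C kappa /\
  forall r f g, r ∈ T -> in_GC kappa theta GC (cmp r p) ->
    maps decode (cmp r p) f -> increasing C theta f ->
    in_GC kappa theta GC (cmp r q) /\
    (maps decode (cmp r q) g ->
     forall b u v, maps g b u -> maps f (suc b) v -> u ∈ v).
Proof.
(* [closure_club] asks for a bound at every [b] below [kappa]; the guard makes the demand trivial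
   outside [theta]. *)
have dB : def3 (fun b d c => b ∈ theta -> Bd b d c).
  by rewrite /Bd /rows_le; dtac.
have [||C [cC HC]] := closure_club _ hkappa _ dB om_lt_kappa.
- move=> b d c c' hc hc' lt H hb r rT rR; have [g [hg h]] := H hb r rT rR.
  exists g; split=> //; apply: ord_trans (kappa_ord _ hkappa _ hc') hg lt.
- move=> b d hb hd; have [ht|nt] := classic (b ∈ theta).
    by have [c [hc h]] := bound_exists _ _ ht hd; exists c.
  by exists d.
exists C; split=> // r f g rT hx hdf hinc.
have hr := T_real _ rT.
have hxr : real (cmp r p) by apply: real_cmp.
have hyr : real (cmp r q) by apply: real_cmp.
have fC := proj1 hinc; have sC := proj1 cC.
have fk := function_weaken _ _ _ _ fC sC.
have hrow b : b ∈ theta -> in_GC_row kappa GC b (cmp r q).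
  move=> hb; apply: T_rows => // b' hb'; apply: (proj2 hx).
  by apply: ole_lt_trans otheta _ hb; apply/lt_suc.
split=> // hdg b u v hbu hbv.
have [hb hu] := decode_value _ _ _ _ hyr hdg hbu.
move/(maps_apE _ _ _ _ (proj1 fC)): hbv => [hsb ->].
have hvC := ap_in _ _ _ _ fC hsb.
have lt : ap f b ∈ ap f (suc b).
  by apply: (proj2 hinc b (suc b)); [exact: in_suc_self| |];
     apply: maps_ap (proj1 fC) _.
have ov := kappa_ord _ hkappa _ (sC _ hvC).
have hbv : b ∈ ap f (suc b).
  by apply: ole_lt_trans ov _ lt; apply: increasing_ge hkappa _ _ _ otheta sC hinc _ hb.
(* The closure property of the point [f(b + 1)] is used with [delta = f(b)], which bounds all values
   of [f] through [b]. *)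
have [|c [hc h]] := HC _ hvC b (ap f b) hbv lt hb r rT.
  move=> b' /lt_suc hb'.
  have hb't := ole_lt_trans _ _ _ otheta hb' hb.
  exists (ap f b'); split; last exact: decode_GC.
  apply/lt_suc; case: hb' => [hb'|->]; last by right.
  by left; apply: (proj2 hinc b' b) => //; apply: maps_ap (proj1 fC) _.
have hck := kappa_trans _ hkappa _ _ (sC _ hvC) hc.
by rewrite (in_GC_at_decode b c (cmp r q) g u).
Qed.

End Bounding.

End Coding.

(** * Blocks *)

Lemma add_om_suc a c : ordinal a -> is_add a om c ->
  ordinal c /\ forall x, x ∈ c -> suc x ∈ c.
Proof.
move=> oa [d [h [/is_succE -> [fh [hc H]]]]].
have dom n : n ∈ om -> n ∈ suc om by move=> hn; apply/in_suc; left.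
have vS n : n ∈ om -> ap h (suc n) = suc (ap h n).
  move=> hn; have hm := maps_ap _ _ _ fh (dom _ hn).
  have [_ [/(_ n (ap h n)) h2 _]] := H _ _ (maps_ap _ _ _ fh (dom _ (om_suc _ hn))).
  by apply/is_succE; apply: h2 => //; apply/is_succE.
have vO : forall n, n ∈ om -> ordinal (ap h n).
  apply: om_ind; first by dtac.
    have [/(_ (in_emp)) -> _] // := H _ _ (maps_ap _ _ _ fh (dom _ om_emp)).
  by move=> n hn IH; rewrite vS //; apply: ord_suc.
have [_ [_ /(_ om_limit) sup]] := H _ _ hc.
have [oc [ub _]] := sup; split=> // x hx.
have [|u [[n [hn hu]] hxu]] := is_sup_lt _ _ _ sup _ hx.
  move=> u [n [hn /(maps_val _ _ _ _ fh) ->]]; exact: vO.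
move: hu hxu => /(maps_val _ _ _ _ fh) -> hxu.
have hsn := om_suc _ hn.
apply: (lt_ole_trans _ (ap h (suc n))) => //.
  by rewrite vS //; apply: suc_mono => //; apply: vO.
apply: ub; exists (suc n); split=> //; exact: maps_ap fh (dom _ hsn).
Qed.

(** Induction along the recursion history: adding [om] gives a supremum of successors, and limit
    stages inherit closure. It ensures that comparing [g(beta)] with [f(beta + 1)] never leaves the
    domain [theta]. *)
Lemma omega_mul_suc a c : ordinal a -> is_omega_mul a c ->
  forall x, x ∈ c -> suc x ∈ c.
Proof.
move=> oa [w [/is_omegaE -> [d [h [/is_succE -> [fh [hc H]]]]]]].
have oS := ord_suc _ oa.
suff K : forall t, ordinal t -> forall y, maps h t y ->
    ordinal y /\ forall x, x ∈ y -> suc x ∈ y by case: (K a oa c hc).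
apply: ord_ind; first by dtac.
move=> t ot IH y hy; have [H0 [HS HL]] := H _ _ hy.
have [/H0 /is_emptyE ->|ne] := classic (is_empty t).
  by split; [apply: ord_emp|move=> x /in_emp].
have hm s : s ∈ t -> maps h s (ap h s).
  move=> hs; apply: (maps_ap _ _ _ fh).
  by apply: ord_trans oS hs (maps_dom _ _ _ _ fh hy).
have [[s /is_succE E]|ns] := classic (exists s, is_succ s t).
  have hs : s ∈ t by rewrite E; apply: in_suc_self.
  have [os _] := IH s hs _ (hm _ hs).
  by apply: (add_om_suc (ap h s)) => //; apply: HS (hm _ hs); apply/is_succE.
have sup := HL (conj ot (conj ne ns)).
have [oy [ub _]] := sup; split=> // x hx.
have [|u [[s [hs hu]] hxu]] := is_sup_lt _ _ _ sup _ hx.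
  by move=> u [s [hs hu]]; case: (IH s hs u hu).
apply: (lt_ole_trans _ u) => //; first by case: (IH s hs u hu) => _; apply.
by apply: ub; exists s.
Qed.

Lemma omega_mul_emp c : is_omega_mul emp c -> is_empty c.
Proof.
move=> [w [_ [d [h [_ [_ [hc /(_ _ _ hc) [H _]]]]]]]].
by apply: H; apply/is_emptyE.
Qed.

Lemma block_unique a f b b' : is_block a f b -> is_block a f b' -> b = b'.
Proof.
move=> [hb H] [hb' H']; apply: (fun_ext _ _ _ hb hb') => c hc.
apply: is_sup_unique (H c _ (maps_ap _ _ _ hb hc)) (H' c _ (maps_ap _ _ _ hb' hc)).
Qed.

(** The blocks of [f] and [g] pooled. It is symmetric in the two, so one payoff can be analysed from
    either side, and it is phrased by [maps], so that it makes sense for arbitrary decoded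
    relations. *)
Definition joint_block (a f g b : V) : Prop :=
  function_on b a /\
  forall c y, maps b c y ->
    is_sup (fun u => exists m k i, is_omega_mul c m /\ natural k /\
      is_add m k i /\ (maps f i u \/ maps g i u)) y.

Lemma def_joint_block : def4 joint_block.
Proof. by rewrite /joint_block /is_sup; dtac. Qed.

Lemma joint_block_comm a f g b : joint_block a f g b -> joint_block a g f b.
Proof.
move=> [hb H]; split=> // c y /H; apply: is_sup_ext => u.
by split=> - [m [k [i [h1 [h2 [h3 h4]]]]]]; exists m, k, i;
  split=> //; split=> //; split=> //; tauto.
Qed.

Lemma is_sup_dominated (P Q : V -> Prop) s :
  (forall u, P u -> Q u) -> (forall u, Q u -> exists v, P v /\ ole u v) ->
  is_sup P s <-> is_sup Q s.
Proof.
move=> PQ QP; have ub u : ordinal u ->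
    (forall a, P a -> ole a u) <-> (forall a, Q a -> ole a u).
  move=> ou; split=> h a; last by move/PQ/h.
  by move=> /QP [v [/h hv le]]; apply: ole_trans ou le hv.
by split=> - [os [h l]]; split=> //; (split; first by apply/ub);
  move=> u ou hu; apply: l => //; apply/ub.
Qed.

(** The values of [f] are cofinal among the pooled values: a value of [g] at position [k] of a block
    is below the value of [f] at position [k + 1] of the same block. *)
Lemma joint_blockE a D K f g b : function f D K ->
  (forall i, i ∈ D -> suc i ∈ D) -> (forall i u, maps g i u -> i ∈ D) ->
  (forall i u v, maps g i u -> maps f (suc i) v -> u ∈ v) ->
  is_block a f b <-> joint_block a f g b.
Proof.
move=> [hf _] hS hg lt.
have E c y : is_sup (fun u => exists m k i,
      is_omega_mul c m /\ natural k /\ is_add m k i /\ maps f i u) y <->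
    is_sup (fun u => exists m k i, is_omega_mul c m /\ natural k /\
      is_add m k i /\ (maps f i u \/ maps g i u)) y.
  apply: is_sup_dominated => u.
    move=> [m [k [i [h1 [h2 [h3 h4]]]]]]; exists m, k, i; tauto.
  move=> [m [k [i [h1 [h2 [h3 [h4|h4]]]]]]].
    by exists u; split; [exists m, k, i|right].
  have hi := maps_ap _ _ _ hf (hS _ (hg _ _ h4)).
  exists (ap f (suc i)); split; last by left; apply: lt h4 hi.
  exists m, (suc k), (suc i); split=> //; split; first exact: nat_suc.
  by split=> //; apply: add_suc => //; apply: nat_ord.
by split=> - [hb H]; split=> // c y /H /E.
Qed.

(** A witness of uniform cofinality satisfies [n <= g(c, n)], so its supremum would be at least
    [om]; yet the value [b(c)] is natural. The contradiction is read off at [n = b(c) + 1]. *)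
Lemma no_increasing_star_om a b : ~ is_empty a -> ~ increasing_star om om a b.
Proof.
move=> ne [[hb _] [[w [P [g [/is_omegaE -> [/is_prodE -> [hg [inc sup]]]]]]] _]].
apply: ne => c hc.
have hp n : n ∈ om -> opair c n ∈ prod a om by move=> hn; apply/in_prod; exists c, n.
have hm n : n ∈ om -> maps2 g c n (ap g (opair c n)).
  move=> hn; exists (opair c n); rewrite is_opairE; split=> //.
  exact: maps_ap (proj1 hg) (hp _ hn).
have go n : n ∈ om -> ap g (opair c n) ∈ om by move=> hn; apply: ap_in hg (hp _ hn).
have ge : forall n, n ∈ om -> ole n (ap g (opair c n)).
  apply: om_ind; first by dtac.
    by apply: emp_le; apply: om_ord; apply: go; apply: om_emp.
  move=> n hn IH; have hsn := om_suc _ hn.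
  apply: suc_le; [exact: om_ord|exact/om_ord/go|].
  apply: ole_lt_trans (om_ord _ (go _ hsn)) IH _.
  by apply: (inc c n (suc n)) => //; [apply: in_suc_self|apply: hm|apply: hm].
have hy := ap_in _ _ _ _ hb hc.
have [oy [ub _]] := sup _ _ (maps_ap _ _ _ (proj1 hb) hc).
have hsy := om_suc _ hy.
apply: (ole_not_lt (suc (ap b c)) (ap b c) oy _ (in_suc_self _)).
apply: ole_trans oy (ge _ hsy) _; apply: ub.
by exists (suc (ap b c)); split=> //; apply: hm.
Qed.

(** * The game *)

Section Game.
Context (kappa lambda theta Gamma decode GC R : V)
  (hcoding : good_coding_system kappa theta Gamma decode GC)
  (theta_suc : forall i, i ∈ theta -> suc i ∈ theta)
  (theta_nonempty : exists beta, beta ∈ theta)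
  (om_lt_kappa : om ∈ kappa)
  (R_real : forall b z, pair_in b z R -> real z).
Implicit Types (sigma tau : V).

#[local] Hint Resolve def_joint_block : defs.

Let hkappa : regular_cardinal kappa := gcs_regular _ _ _ _ _ hcoding.
Let otheta : ordinal theta := gcs_ordinal _ _ _ _ _ hcoding.

Notation row b x := (in_GC_row kappa GC b x).
Notation xpart r := (cmp r ix).
Notation ypart r := (cmp r iy).
Notation zpart r := (cmp r iz).

(** II leaves the rows strictly before I. If both fail first at the same row, no [b] qualifies, so
    the tie is charged to I. *)
Definition violation (r : V) : Prop := exists b, b ∈ theta /\
  (forall c, c ∈ b -> row c (xpart r) /\ row c (ypart r)) /\
  row b (xpart r) /\ ~ row b (ypart r).

Definition not_uniformized (r : V) : Prop :=
  (forall b, b ∈ theta -> row b (xpart r)) /\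
  (forall b, b ∈ theta -> row b (ypart r)) /\
  exists h z, pair_in h z R /\ ~ pair_in h (zpart r) R /\
    joint_block lambda (ap decode (xpart r)) (ap decode (ypart r)) h.

Definition payoff : V := sep RR (fun r => violation r \/ not_uniformized r).

Lemma in_payoff r :
  r ∈ payoff <-> real r /\ (violation r \/ not_uniformized r).
Proof.
rewrite in_sep ?in_RR //.
by rewrite /violation /not_uniformized /in_GC_row; dtac.
Qed.

Lemma def_plays sigma (turn : V -> Prop) : def1 turn -> def1 (plays sigma turn).
Proof. by move=> dt; rewrite /plays; dtac. Qed.

Lemma consistent_runs sigma (turn : V -> Prop) : def1 turn ->
  forall r, r ∈ sep RR (plays sigma turn) <-> real r /\ plays sigma turn r.
Proof. by move=> dt r; rewrite in_sep ?in_RR //; apply: def_plays. Qed.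

Lemma Del_runs sigma (turn : V -> Prop) : strategy sigma -> def1 turn ->
  (forall n, turn n -> n ∈ om) ->
  Del Gamma (fun r => r ∈ sep RR (plays sigma turn)).
Proof.
move=> hs dt ht.
have := Del_plays _ _ _ _ _ hcoding theta_nonempty om_lt_kappa sigma turn hs dt ht.
by apply: Del_ext => r hr; rewrite consistent_runs //; tauto.
Qed.

(** A violation at some [b <= beta] would contradict that [y] is in its rows through [beta]; so it
    happens later, and up to it [x] is in its rows as well. *)
Lemma first_player_rows r beta : r ∈ payoff -> beta ∈ theta ->
  (forall c, c ∈ suc beta -> row c (ypart r)) -> row beta (xpart r).
Proof.
move=> /in_payoff [hr H] hb hy; case: H => [[b [hbt [hlt [hxb hyb]]]]|[h _]].
  have ob := ord_elem _ _ otheta hb.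
  case: (ole_total _ _ (ord_elem _ _ otheta hbt) ob) => [/lt_suc /hy|] //.
  by move/hlt=> [].
exact: h.
Qed.

(** By induction II is in all rows before [b]; a failure at [b], with [x] still in its rows, would
    then be a violation. *)
Lemma second_player_rows r beta : real r -> ~ r ∈ payoff -> beta ∈ theta ->
  (forall c, c ∈ suc beta -> row c (xpart r)) -> row beta (ypart r).
Proof.
move=> hr nr hb; move: (ord_elem _ _ otheta hb) (hb); move: beta {hb}.
apply: (ord_ind (fun beta => beta ∈ theta ->
  (forall c, c ∈ suc beta -> row c (xpart r)) -> row beta (ypart r))).
  by rewrite /in_GC_row; dtac.
move=> b ob IH hb hx; apply: NNPP => n; apply: nr; apply/in_payoff; split=> //.
left; exists b; split=> //; split.
  move=> c hc; split; first by apply: hx; apply/in_suc; left.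
  apply: IH => //; first exact: ord_trans otheta hc hb.
  move=> d /lt_suc hd; apply: hx; apply/lt_suc; left.
  exact: ole_lt_trans ob hd hc.
by split=> //; apply: hx; apply: in_suc_self.
Qed.

Lemma first_player_loses sigma : strategy sigma ->
  ~ (forall r, real r -> plays sigma even r -> r ∈ payoff).
Proof.
move=> hs win.
have hix := real_ix; have hiy := real_iy; have hiz := real_iz.
have inT := consistent_runs sigma even def_even.
have [||C [cC HC]] := bounding_club _ _ _ _ _ hcoding theta_nonempty om_lt_kappa
  (sep RR (plays sigma even)) iy ix hiy hix
  (Del_runs _ _ hs def_even even_om).
- by move=> r /inT [].
- move=> r beta /inT [hr pr]; apply: first_player_rows; exact: win.
have [f hf] := increasing_exists _ hkappa _ _ otheta (gcs_le _ _ _ _ _ hcoding) cC.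
have fk := function_weaken _ _ _ _ (proj1 hf) (proj1 cC).
have [y [hy hd]] := gcs_decode_onto _ _ _ _ _ hcoding _ fk.
have yGC b : b ∈ theta -> row b y.
  move=> hb; exists (ap f b); split; first exact: ap_in fk hb.
  exact: decode_GC hcoding _ _ hy hd fk _ hb.
(* The function to be uniformized is block(f), known before the run is played, so a single [z] is
   enough. If block(f) is outside dom(R), any real will do. *)
have [z [hz Hz]] : exists z, real z /\ forall h z', pair_in h z' R ->
    is_block lambda f h -> pair_in h z R.
  have [[h [z [hR hb]]]|n] :=
    classic (exists h z, pair_in h z R /\ is_block lambda f h).
    exists z; split; first exact: R_real hR.
    by move=> h' z' _ hb'; rewrite (block_unique _ _ _ _ hb' hb).
  exists zero; split; first exact: real_zero.
  by move=> h z' hR hb; case: n; exists h, z'.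
(* The opponent of I plays the code [y] and the real [z] regardless of the moves of I. *)
have [w [hw [Ey [Ez _]]]] := merge iy iz y z hiy hiz hy hz iy_inj iz_inj iy_neq_iz.
have [r [hr [pr nr]]] := run_exists sigma even w hs def_even even_om hw.
have part j : real j -> (forall n, n ∈ om -> odd (ap j n)) -> cmp r j = cmp w j.
  move=> hj oj; apply: real_ext; try exact: real_cmp.
  move=> n hn; rewrite (ap_cmp r) // (ap_cmp w) //; apply: nr.
    exact: real_ap.
  by move=> e; apply: (even_not_odd _ e); apply: oj.
have Ey' : ypart r = y by rewrite -Ey; apply: part hiy odd_iy.
have Ez' : zpart r = z by rewrite -Ez; apply: part hiz odd_iz.
have hrT : r ∈ sep RR (plays sigma even) by apply/inT.
have := HC r f (ap decode (xpart r)) hrT; rewrite Ey' => - [] //.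
move=> [hx _] H.
have hxd : maps decode (xpart r) (ap decode (xpart r)).
  by apply/(decodeE _ _ _ _ _ hcoding).
(* [y] is in all its rows, so I must have won by a failure of [z] at the pooled block function,
   which turns out to be block(f). *)
have /in_payoff [_ [[b [hb [_ [_ n]]]]|[_ [_ [h [z' [hR [nR jb]]]]]]]] := win r hr pr.
  by apply: n; rewrite Ey'; apply: yGC.
apply: nR; rewrite Ez'; apply: (Hz h z') => //.
apply/(joint_blockE _ _ _ _ (ap decode (xpart r)) _ fk theta_suc).
- by move=> i u hu; case: (decode_value _ _ _ _ _ hcoding _ _ _ _ hx hxd hu).
- exact: H.
apply: joint_block_comm; move: jb.
by rewrite Ey'; move/(decodeE _ _ _ _ _ hcoding _ _ hy): hd => <-.
Qed.

(** The run against [x] keeps both players in all rows and its pooled block function is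
    block(decode(x)). If [z] failed to uniformize there, the run would be won by I. *)
Lemma second_player_uniformizes tau : strategy tau ->
  (forall r, real r -> plays tau odd r -> ~ r ∈ payoff) ->
  exists C F : V, club C kappa /\ lipschitz F /\
    forall x f b : V,
      in_GC kappa theta GC x ->
      maps decode x f -> increasing C theta f ->
      is_block lambda f b ->
      (exists y, pair_in b y R) ->
      exists z, maps F x z /\ pair_in b z R.
Proof.
move=> ht win.
have hix := real_ix; have hiy := real_iy; have hiz := real_iz.
have inT := consistent_runs tau odd def_odd.
have [||C [cC HC]] := bounding_club _ _ _ _ _ hcoding theta_nonempty om_lt_kappa
  (sep RR (plays tau odd)) ix iy hix hiy
  (Del_runs _ _ ht def_odd odd_om).
- by move=> r /inT [].
- by move=> r beta /inT [hr pr]; apply: second_player_rows => //; apply: win.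
have [F [lF HF]] := second_player_lipschitz tau ht.
exists C, F; split=> //; split=> // x f b hx hd hinc hb [z0 hR].
have [r [hr [pr [Ex hF]]]] := HF x (proj1 hx).
exists (zpart r); split=> //; apply: NNPP => nR.
apply: (win r hr pr); apply/in_payoff; split=> //; right.
have hrT : r ∈ sep RR (plays tau odd) by apply/inT.
have := HC r f (ap decode (ypart r)) hrT; rewrite Ex => - [] //.
move=> [hy rows] H.
have hyd : maps decode (ypart r) (ap decode (ypart r)).
  by apply/(decodeE _ _ _ _ _ hcoding).
split; first by rewrite Ex; case: hx.
split=> //; exists b, z0; split=> //; split=> //.
have fk := function_weaken _ _ _ _ (proj1 hinc) (proj1 cC).
rewrite Ex; move/(decodeE _ _ _ _ _ hcoding _ _ (proj1 hx)): (hd) => <-.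
apply/(joint_blockE _ _ _ _ _ _ fk theta_suc) => //.
- by move=> i u hu; case: (decode_value _ _ _ _ _ hcoding _ _ _ _ hy hyd hu).
- exact: H.
Qed.

End Game.

End SetTheory.

Theorem theorem3p8 (V : setStructure) (hZF : ZF V) (hAD : AD V)
  (kappa lam theta Gamma decode GC R : V)
  (hkappa : regular_cardinal kappa)
  (hlam : lam ∈ kappa)
  (htheta : is_omega_mul lam theta)
  (hcoding : good_coding_system kappa theta Gamma decode GC)
  (hR : forall p, p ∈ R ->
     exists f x, increasing_star kappa kappa lam f /\ real x /\ is_opair f x p) :
  exists C F : V, club C kappa /\ lipschitz F /\
    forall x f b : V,
      in_GC kappa theta GC x ->
      maps decode x f -> increasing C theta f ->
      is_block lam f b -> increasing_star kappa C lam b ->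
      (exists y, pair_in b y R) ->
      exists z, maps F x z /\ pair_in b z R.
Proof.
have olam : ordinal lam by apply: ord_elem (proj1 (proj1 hkappa)) hlam.
have R_real b z : pair_in b z R -> real z.
  move/(mapsE hZF) => /hR [f [x [_ [hx /(is_opairE hZF) E]]]].
  by have [_ ->] := opair_inj hZF _ _ _ _ E.
(* With [theta] empty there is no set GC_{beta,gamma} from which to obtain clopen sets. Here every
   decoded function is empty, so at most one block function occurs and a constant [F] suffices. *)
have [ne|empty] := classic (exists beta, beta ∈ theta); last first.
  have f0 f : function_on f theta -> is_empty f.
    by move=> [h _] p /h [a [b [ha _]]]; apply: empty; exists a.
  have [z [hz Hz]] : exists z, real z /\ forall f b z', function_on f theta ->
      is_block lam f b -> pair_in b z' R -> pair_in b z R.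
    have [[f [b [z [hf [hb hbz]]]]]|n] := classic (exists f b z,
        function_on f theta /\ is_block lam f b /\ pair_in b z R).
      exists z; split; first exact: R_real hbz.
      move=> f' b' z' /f0 /(is_emptyE hZF) E' hb' _.
      move/f0: hf => /(is_emptyE hZF) E.
      by rewrite (block_unique hZF _ _ _ b hb') // E' -E.
    exists (zero hZF); split; first exact: real_zero.
    by move=> f b z' hf hb h; case: n; exists f, b, z'.
  have [F [lF HF]] := constant_lipschitz hZF z hz.
  exists kappa, F; split; first exact: kappa_club hZF _ hkappa.
  split=> // x f b [hx _] _ [[hf _] _] hb _ [z' hz'].
  by exists z; split; [apply: HF|apply: Hz hb hz'].
(* If [kappa] is [om], no block function of correct type exists: [lam] is nonempty because [theta]
   is. The conclusion holds vacuously with any club and any [F]. *)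
case: (om_le_kappa hZF _ hkappa) => [om_lt|E]; last first.
  have [F [lF _]] := constant_lipschitz hZF _ (real_zero hZF).
  exists kappa, F; split; first exact: kappa_club hZF _ hkappa.
  split=> // x f b _ _ _ _ hb _; move: hb; rewrite -E => /no_increasing_star_om [] //.
  move=> /(is_emptyE hZF) E0; case: ne => beta; rewrite E0 in htheta.
  exact: (omega_mul_emp hZF _ htheta).
have theta_suc := omega_mul_suc hZF _ _ olam htheta.
have [|[sigma [hs win]]|[tau [ht win]]] :=
  hAD (payoff hZF kappa lam theta decode GC R).
- by move=> x /(in_payoff hZF) [].
- by case: (first_player_loses hZF kappa lam theta Gamma decode GC R hcoding
    theta_suc ne om_lt R_real sigma hs).
have [C [F [cC [lF H]]]] := second_player_uniformizes hZF kappa lam theta Gamma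
  decode GC R hcoding theta_suc ne om_lt tau ht win.
exists C, F; split=> //; split=> // x f b hx hd hi hb _.
exact: H hx hd hi hb.
Qed.
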